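(* For any initial time $m\ge 1$ and any $C\ge 7$, $$\mathbb{P}\left(\exists t\ge m:\ \|\widehat F_t-F\|_\infty > 0.85\sqrt{\frac{\log\log(et/m)+C}{t}}\right)\le 1612\,e^{-1.25C}.$$ Furthermore, for any $A>1/\sqrt2$, $C>0$, and $m\ge1$, $$\mathbb{P}\left(\|\widehat F_t-F\|_\infty > A\sqrt{\frac{\log\log(et/m)+C}{t}}\ \text{ for infinitely many } t\right)=0.$$
   Context: $(X_i)_{i=1}^\infty$ is a sequence of i.i.d. observations taking values in a complete, totally ordered set $(\mathcal{X},\le)$; $F(x):=\mathbb{P}(X_1\le x)$; $\widehat F_t(x):=t^{-1}\sum_{i=1}^t\mathbf{1}\{X_i\le x\}$ for $t\in\mathbb{N}$; $\|g\|_\infty:=\sup_{x\in\mathcal{X}}|g(x)|$. The time index $t$ ranges over positive integers.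
   Formalization: Added assumption: P(X_1∈D)=sup_{x∈D}P(X_1≤x) for nonempty initial segments D, and dually for final segments (automatic on the real line). Without it the claim fails, e.g. on [0,ω_1] with mass 0 on countable sets below ω_1 and mass 1 on [0,ω_1); the claim itself forces it. *)

(* Defs.v *)
From HB Require Import structures.
From mathcomp Require Import all_boot all_order all_algebra finmap.
From mathcomp Require Import all_classical all_reals all_analysis.

Set Implicit Arguments.
Unset Strict Implicit.
Unset Printing Implicit Defensive.

Import Order.TTheory GRing.Theory Num.Theory.

Local Open Scope classical_set_scope.
Local Open Scope ring_scope.

(* Completeness in the sense of the least-upper-bound property (Dedekind
   completeness), so that the real line qualifies. *)
Definition order_complete {d} (X : orderType d) : Prop :=
  forall A : set X, has_sup A -> supremums A !=set0.

(* The sigma-algebra of X is the one generated by the rays, the smallest for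
   which both X_1 <= x and X_1 < x are events. The i.i.d. hypothesis for any
   larger sigma-algebra, such as the Borel one of the order topology, implies
   the one used here. *)
Definition rays {d} (X : orderType d) : set (set X) :=
  [set B | exists a : X,
     B = [set x | (x <= a)%O] \/ B = [set x | (x < a)%O]].

Definition ray_measurable {d} {X : orderType d} : set (set X) :=
  <<s @rays d X >>.

Definition supnorm {R : realType} {X : Type} (g : X -> R) : \bar R :=
  ereal_sup (range (fun x => `|g x|%:E)).

Section RandomElements.
Context {R : realType} {dT : measure_display} {T : measurableType dT}.
Context {dX : Order.disp_t} {X : orderType dX}.
Variable P : probability T R.

Definition random_element (Y : T -> X) : Prop :=
  forall B, ray_measurable B -> measurable (Y @^-1` B).

Definition identically_distributed (Xs : nat -> T -> X) : Prop :=
  forall i B, ray_measurable B -> P (Xs i @^-1` B) = P (Xs 0%N @^-1` B).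

Definition mutually_independent (Xs : nat -> T -> X) : Prop :=
  forall (J : {fset nat}) (B : nat -> set X),
    (forall i, i \in J -> ray_measurable (B i)) ->
    P (\bigcap_(i in [set` J]) (Xs i @^-1` B i)) =
    (\prod_(i <- J) P (Xs i @^-1` B i))%E.

Definition iid (Xs : nat -> T -> X) : Prop :=
  [/\ forall i, random_element (Xs i),
      identically_distributed Xs &
      mutually_independent Xs].

(* Regularity of the law of Y along the order: F(x) = P(Y <= x) is
   right-continuous for the order topology, its left limit at a is P(Y < a),
   and it tends to 1 (resp. 0) along X when X has no maximum (resp. minimum).
   For laws on the real line, and on any X with a separable order topology,
   this is automatic (separable_order_regular below). On an arbitrary complete
   order it is an actual restriction, and it is necessary for F_t to converge
   to F uniformly: on the ordinals <= omega_1, with the law giving mass 0 to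
   the countable sets of ordinals < omega_1 and 1 to their complements in
   [0, omega_1[, one has F = 0 below omega_1 whereas F_t reaches 1 there, so
   that ||F_t - F|| = 1 almost surely for all t. *)
Definition order_regular (Y : T -> X) : Prop :=
  (forall D : set X, D !=set0 ->
     (forall x y, D y -> (x <= y)%O -> D x) ->
     P (Y @^-1` D) = ereal_sup [set P [set w | (Y w <= x)%O] | x in D]) /\
  (forall U : set X, U !=set0 ->
     (forall x y, U y -> (y <= x)%O -> U x) ->
     P (Y @^-1` U) = ereal_sup [set P [set w | (x <= Y w)%O] | x in U]).

Definition order_cdf (Y : T -> X) (x : X) : R :=
  fine (P [set w | (Y w <= x)%O]).

(* The i-th observation (i >= 1) is Xs i.-1. *)
Definition empirical_cdf (Xs : nat -> T -> X) (t : nat) (w : T) (x : X) : R :=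
  t%:R^-1 * \sum_(i < t) ((Xs i w <= x)%O)%:R.

Definition cdf_deviation (Xs : nat -> T -> X) (t : nat) (w : T) : \bar R :=
  supnorm (empirical_cdf Xs t w \- order_cdf (Xs 0%N)).

End RandomElements.

Definition lil_boundary {R : realType} (A C m : R) (t : nat) : R :=
  A * Num.sqrt ((ln (ln (expR 1 * t%:R / m)) + C) / t%:R).

Section Separable.
Context {R : realType} {dT : measure_display} {T : measurableType dT}.
Context {dX : Order.disp_t} {X : orderType dX}.
Variable P : probability T R.

Let cofinal_regular (r : rel X) (Y : T -> X) (D : set X) (u : nat -> X) :
  reflexive r -> transitive r -> total r ->
  (forall x, measurable [set w | r (Y w) x]) ->
  (forall x y, D y -> r x y -> D x) ->
  (forall n, D (u n)) -> (forall x, D x -> exists n, r x (u n)) ->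
  P (Y @^-1` D) = ereal_sup [set P [set w | r (Y w) x] | x in D].
Proof.
move=> rr rt rtot mG Dl Du cof.
pose A n := [set w | r (Y w) (u n)].
have YD : Y @^-1` D = \bigcup_n A n.
  apply/seteqP; split=> w /=; first by move=> /cof[n rn]; exists n.
  by move=> [n _ rn]; exact: Dl (Du n) rn.
have mD : measurable (Y @^-1` D) by rewrite YD; apply: bigcup_measurable => n _; exact: mG.
apply/eqP; rewrite eq_le; apply/andP; split; last first.
  apply: ge_ereal_sup => _ [x Dx <-]; apply: le_measure; rewrite ?inE //.
  by move=> w /= rw; exact: Dl Dx rw.
have /all_sig[v vP] n : {v : X | D v /\
    \big[setU/set0]_(i < n.+1) A i = [set w | r (Y w) v]}.
  apply: cid; elim: n => [|n [v [Dv IH]]].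
    by exists (u 0); split => //; rewrite big_ord1.
  rewrite big_ord_recr /= IH; have [vu|uv] := orP (rtot v (u n.+1)).
    exists (u n.+1); split => //; apply/setUidPr => w /= rw; exact: rt rw vu.
  by exists v; split => //; apply/setUidPl => w /= rw; exact: rt rw uv.
pose B n := \big[setU/set0]_(i < n.+1) A i.
have mB n : measurable (B n) by rewrite /B (vP n).2.
have BE : \bigcup_n B n = Y @^-1` D.
  rewrite YD; apply/seteqP; split=> w /=.
    by move=> [n _]; rewrite /B -bigcup_mkord => -[k _ Ak]; exists k.
  by move=> [n _ An]; exists n => //; rewrite /B -bigcup_mkord; exists n => /=.
have := @nondecreasing_cvg_mu _ _ _ P B mB _ _.
rewrite BE => /(_ mD) cvB.
have {}cvB : P \o B @ \oo --> P (Y @^-1` D).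
  by apply: cvB => n k nk; apply/subsetPset; exact: subset_bigsetU.
rewrite -(cvg_lim _ cvB)//; apply: lime_le; first by apply/cvg_ex; eexists; exact: cvB.
apply: nearW => n /=; apply: ereal_sup_ubound.
by exists (v n); [exact: (vP n).1|rewrite /B (vP n).2].
Qed.

Let cofinal_seq (r : rel X) (D : set X) (q : nat -> X) :
  total r -> D !=set0 -> (forall x y, D y -> r x y -> D x) ->
  (forall x y z, ~~ r y x -> ~~ r z y -> exists n, r x (q n) && r (q n) z) ->
  exists u : nat -> X,
    (forall n, D (u n)) /\ (forall x, D x -> exists n, r x (u n)).
Proof.
move=> rtot [x0 Dx0] Dl dq.
have [[m Dm mmax]|nomax] := pselect (exists2 m, D m & forall x, D x -> r x m).
  by exists (fun=> m); split => // x Dx; exists 0; exact: mmax.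
exists (fun n => if pselect (D (q n)) then q n else x0); split.
  by move=> n; case: pselect.
have up x : D x -> exists2 y, D y & ~~ r y x.
  move=> Dx; apply: contrapT => h; apply: nomax; exists x => // y Dy.
  by apply: contrapT => /negP ryx; apply: h; exists y.
move=> x Dx; have [y Dy yx] := up _ Dx; have [z Dz zy] := up _ Dy.
have [n /andP[xn nz]] := dq _ _ _ yx zy.
by exists n; case: pselect => //= nD; exfalso; apply: nD; exact: Dl Dz nz.
Qed.

Lemma separable_order_regular (Y : T -> X) (q : nat -> X) :
  random_element Y ->
  (forall x z, (exists y, (x < y < z)%O) -> exists n, (x < q n < z)%O) ->
  order_regular P Y.
Proof.
move=> mY dq.
have mle a : measurable [set w | (Y w <= a)%O].
  by apply: (mY [set x | (x <= a)%O]); apply: sub_sigma_algebra; exists a; left.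
have mge a : measurable [set w | (a <= Y w)%O].
  rewrite (_ : mkset _ = ~` (Y @^-1` [set x | (x < a)%O])).
    apply: measurableC; apply: mY; apply: sub_sigma_algebra.
    by exists a; right.
  by apply/seteqP; split=> w /=; rewrite leNgt => /negP.
split=> D D0 Dl.
- have [||u [Du cof]] := @cofinal_seq <=%O D q _ D0 Dl; first exact: le_total.
    move=> x y z; rewrite -!ltNge => xy yz.
    have [|n /andP[xn nz]] := dq x z; first by exists y; rewrite xy yz.
    by exists n; rewrite !ltW.
  by apply: (@cofinal_regular <=%O Y D u);
    [exact: le_refl|exact: le_trans|exact: le_total|..].
- have [||u [Du cof]] := @cofinal_seq >=%O D q _ D0 Dl; first exact: ge_total.
    move=> x y z; rewrite /= -!ltNge => yx zy.
    have [|n /andP[zn nx]] := dq z x; first by exists y; rewrite zy yx.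
    by exists n; rewrite !ltW.
  by apply: (@cofinal_regular >=%O Y D u);
    [exact: ge_refl|exact: ge_trans|exact: ge_total|..].
Qed.

End Separable.

(* Main.v *)
Require Import Defs.
From HB Require Import structures.
From mathcomp Require Import all_boot all_order all_algebra finmap.
From mathcomp Require Import all_classical all_reals all_analysis.
From mathcomp Require Import measurable_realfun ring lra.

(** Cut the order into finitely many nested sets; everything rests on a bound,
    at a fixed time [n], for the probability that some set [U] of a chain, of
    probability [u], receives more than [n (u + a)] of the [n] observations.
    Let the chain be scanned from one end, and let the law of an observation
    be tilted by a constant factor on the part already scanned.  The likelihood
    ratio of the observations, known only up to the scanned sets, is a
    martingale along the scan, so it ever reaches [c] with probability at most
    [1/c] ([scan_bound]); it remains to see that it is large at a crossing.

    - Scan downwards, with the tilt that is optimal for variance 1/4 at mass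
      [g].  By convexity the tilt stays nearly optimal at the masses around [g]
      ([ln_tilt_near]), and Hoeffding's inequality gives the exponent
      [2 (1 - d^2) n a^2] for all sets of mass within the factors [1/(1 + d)]
      and [1/(1 - d)] of [g] ([crossing_in_band]).
    - No finite number of such bands reaches down to mass 0.  For masses at
      most 17/100 the chain is scanned upwards with the factor [exp(2a)], and the exponent is
      the full [2 n a^2] ([crossing_sparse]).

    Finitely many bands cover [17/100, 1], whence an inequality of
    Dvoretzky-Kiefer-Wolfowitz type with an exponent as close to [2 n a^2] as
    desired and an explicit constant, 6 for the choice made below
    ([crossing_bound]).

    In time, the maximal excess [V] over the chain is a submartingale.  Doob's
    inequality is applied to the positive part of [V - z] with [z] just below
    the level: the tail bound integrates to a loss of a factor close to [e]
    only, without a polynomial factor ([epoch_crossing]).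

    To pass to the observations, the quantile cuts at the multiples of [1/K]
    bracket the distribution function up to [1/K]; here the regularity of the
    law enters.  All these cuts are countably many, which also makes the
    exceedance events measurable ([bracket], [exceedance_measurable]).

    Finally time is cut into epochs [m exp(l k) <= t < m exp(l (k + 1))].  On
    the k-th one the boundary is crossed with probability at most a constant
    times [exp(- q C) (1 + l k)^(- q)], where
    [q <= 2 (1 - d^2) A^2 exp(- l)] ([one_epoch_bound]), which is summable for
    [q > 1].  Numerical values of [d], [l], [q] give the first bound.  For the
    second, [A > 1/sqrt 2] is exactly what allows [q > 1], and exceedance for
    infinitely many times is contained in every tail of the epochs, hence has
    probability at most every tail of a convergent series. *)

Import Order.TTheory GRing.Theory Num.Theory.
Import numFieldNormedType.Exports.

Local Open Scope classical_set_scope.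
Local Open Scope ring_scope.

Set Implicit Arguments.
Unset Strict Implicit.
Unset Printing Implicit Defensive.

(** * Bernoulli tilts *)

Section Calculus.
Context {R : realType}.
Implicit Types (a s w x : R).

Lemma derive_ge0_le (f df : R -> R) (a b : R) : a <= b ->
  (forall x, a <= x <= b -> is_derive x 1 f (df x)) ->
  (forall x, a <= x <= b -> 0 <= df x) -> f a <= f b.
Proof.
move=> ab fdf df0.
have [||x] := @MVT_segment R f df a b ab.
- by move=> x; rewrite in_itv /= => /andP[ax xb]; apply: fdf; rewrite !ltW.
- apply: derivable_within_continuous => x; rewrite in_itv /= => /fdf.
  by case.
rewrite in_itv /= => xab; rewrite -subr_ge0 => ->.
by rewrite mulr_ge0 ?df0// subr_ge0.
Qed.

(** Hoeffding's lemma for a Bernoulli variable of mean [w]: the second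
    derivative of its log-moment generating function is the variance of a
    tilted Bernoulli variable, hence at most 1/4. *)
Lemma hoeffding_bernoulli w s : 0 <= w <= 1 -> 0 <= s ->
  1 - w + w * expR s <= expR (w * s + s ^+ 2 / 8).
Proof.
move=> /andP[w0 w1] s0.
pose D x := 1 - w + w * expR x.
have D0 x : 0 < D x.
  rewrite /D; have := expR_gt0 x.
  move: w0; rewrite le_eqVlt => /predU1P[<-|w0] e0; first by lra.
  by have := mulr_gt0 w0 e0; lra.
pose q x := w * expR x / D x.
have dD x : is_derive x 1 D (w * expR x).
  by apply: is_derive_eq; rewrite /GRing.scale /=; lra.
have dq x : is_derive x 1 q (q x * (1 - q x)).
  have ? : D x != 0 by rewrite gt_eqF.
  rewrite /q; apply: is_derive_eq; rewrite /GRing.scale /=.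
  by field.
pose g x := w + x / 4 - q x.
have dg x : is_derive x 1 g (1 / 4 - q x * (1 - q x)).
  by rewrite /g; apply: is_derive_eq; rewrite /GRing.scale /=; lra.
have g0 x : 0 <= x -> 0 <= g x.
  move=> x0; have -> : 0 = g 0.
    rewrite /g /q /D expR0; have -> : 1 - w + w * 1 = 1 by ring.
    by field.
  apply: (derive_ge0_le x0 (df := fun x => 1 / 4 - q x * (1 - q x))) => // y _.
  by move: (q y) => z /=; have := sqr_ge0 (z - 1 / 2); rewrite expr2; lra.
pose f x := w * x + x ^+ 2 / 8 - ln (D x).
have df x : is_derive x 1 f (g x).
  have ? : D x != 0 by rewrite gt_eqF.
  have dl : is_derive x 1 (@ln R \o D) ((D x)^-1 * (w * expR x)).
    apply: is_derive1_comp; exact: is_derive1_ln.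
  rewrite /f; apply: is_derive_eq; rewrite /GRing.scale /= /g /q.
  by field.
rewrite -[leLHS]lnK ?posrE ?D0// ler_expR -subr_ge0.
have -> : 0 = f 0.
  rewrite /f /D expR0; have -> : 1 - w + w * 1 = 1 by ring.
  by rewrite ln1; field.
apply: (derive_ge0_le s0 (df := g)) => // x /andP[x0 _]; exact: g0.
Qed.

(** The tangent line of [expR] at [w * s], evaluated at [s] and at 0, is
    averaged with the weights [w] and [1 - w]. *)
Lemma expR_chord w s : 0 <= w <= 1 -> expR (w * s) <= 1 + w * (expR s - 1).
Proof.
move=> /andP[w0 w1].
have h1 : expR (w * s) * (1 + (1 - w) * s) <= expR s.
  have -> : expR s = expR (w * s) * expR ((1 - w) * s).
    by rewrite -expRD; congr expR; ring.
  by rewrite ler_wpM2l ?expR_ge0// expR_ge1Dx.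
have h2 : expR (w * s) * (1 - w * s) <= 1.
  rewrite -[leRHS]expR0 -(subrr (w * s)) expRD.
  by rewrite ler_wpM2l ?expR_ge0// expR_ge1Dx.
have := lerD (ler_wpM2l w0 h1) (ler_wpM2l (_ : 0 <= 1 - w) h2).
by rewrite subr_ge0 => /(_ w1); lra.
Qed.

(** A tilt of log-odds [a] at mass [g] has the log-odds
    [ln (1 + w * (expR a - 1))] at mass [g / w].  By convexity they stay
    between [a] and [w * a], so a tilt tuned to one mass is nearly optimal for
    the masses around it; the loss in the exponent is quadratic in [d]. *)
Lemma ln_tilt_near d a w : 0 <= d < 1 -> 0 <= a -> 1 - d <= w <= 1 + d ->
  (ln (1 + w * (expR a - 1)) - a) ^+ 2 <= (d * a) ^+ 2.
Proof.
move=> /andP[d0 d1] a0 /andP[w1 w2].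
have w0 : 0 < w by lra.
set E := expR a.
have E1 : 1 <= E by rewrite -[1]expR0 ler_expR.
have X0 : 0 < 1 + w * (E - 1).
  by have := mulr_ge0 (ltW w0) (_ : 0 <= E - 1); rewrite subr_ge0 => /(_ E1); lra.
set s := ln _.
have es : expR s = 1 + w * (E - 1) by rewrite lnK ?posrE.
suff : (1 - d) * a <= s <= (1 + d) * a.
  move=> /andP[h1 h2]; rewrite -subr_ge0 subr_sqr mulr_ge0//; lra.
case: (leP w 1) => w1'.
  have h1 : w * a <= s by rewrite -ler_expR es expR_chord// ltW.
  have h2 : s <= a.
    rewrite -ler_expR es -/E -subr_ge0.
    have -> : E - (1 + w * (E - 1)) = (1 - w) * (E - 1) by ring.
    by rewrite mulr_ge0 ?subr_ge0.
  have := ler_wpM2r a0 w1; have := mulr_ge0 d0 a0; lra.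
have h1 : a <= s.
  rewrite -ler_expR es -/E -subr_ge0.
  have -> : (1 + w * (E - 1)) - E = (w - 1) * (E - 1) by ring.
  by rewrite mulr_ge0 ?subr_ge0// ltW.
have h2 : w^-1 * s <= a.
  rewrite -ler_expR -/E; apply: le_trans (expR_chord _ _) _.
    by rewrite invr_ge0 ltW//= invf_le1// ltW.
  rewrite es; have -> : 1 + w^-1 * (1 + w * (E - 1) - 1) = E by field; rewrite gt_eqF.
  by [].
have h3 : s <= w * a by rewrite mulrC ler_pdivrMr// mulrC in h2.
have := ler_wpM2r a0 w2; have := mulr_ge0 d0 a0; lra.
Qed.

(** The diagonal Padé approximation; it is accurate enough at small [a], as
    well as up to [a = 1], for [sparse_derivative_bound]. *)
Lemma expR_le_pade a : 0 <= a <= 1 -> (2 - a) * expR a <= 2 + a.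
Proof.
move=> /andP[a0 a1].
pose f x := 2 + x - (2 - x) * expR x.
have df x : is_derive x 1 f (1 - (1 - x) * expR x).
  by apply: is_derive_eq; rewrite /GRing.scale /=; ring.
have f0 : f 0 = 0 by rewrite /f expR0; ring.
rewrite -subr_ge0 -/(f a) -f0.
apply: (derive_ge0_le a0 (df := fun x => 1 - (1 - x) * expR x)) => // x _.
have := expR_ge1Dx (- x); rewrite expRN.
by rewrite -(ler_pM2r (expR_gt0 x)) mulVf ?gt_eqF ?expR_gt0//; lra.
Qed.

(** With [c] replaced by its lower bound [((2 - a) / (2 + a))^2] and
    [m := 1 - a], the difference of the two sides is a positive multiple of
    [m * (1 - x)^2 - 4 * x^2].  Since [x <= m], this is nonnegative as soon as
    [4 * x <= (1 - x)^2], that is up to [x = 3 - 2 * sqrt 2], which is just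
    above 17/100. *)
Lemma sparse_derivative_bound a x c : 0 < a <= 1 -> 0 <= x <= 17 / 100 ->
  x <= 1 - a -> (2 - a) ^+ 2 <= c * (2 + a) ^+ 2 -> c <= 1 ->
  (1 - c) * (1 - a - x) ^+ 2 <= 2 * a * (1 - a) * (1 - x) * (c - x).
Proof.
move=> /andP[a0 a1] /andP[x0 x1] xa hc c1.
set m := 1 - a; have am : a = 1 - m by rewrite /m; ring.
have key : 0 <= (2 + a) ^+ 2 * (2 * a * m * (1 - x) * (c - x) - (1 - c) * (m - x) ^+ 2).
  have -> : (2 + a) ^+ 2 * (2 * a * m * (1 - x) * (c - x) - (1 - c) * (m - x) ^+ 2)
    = (c * (2 + a) ^+ 2 - (2 - a) ^+ 2) * (2 * a * m * (1 - x) + (m - x) ^+ 2)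
      + 2 * a * a ^+ 2 * (m * (1 - x) ^+ 2 - 4 * x ^+ 2).
    by rewrite am; ring.
  apply: addr_ge0; apply: mulr_ge0.
  - by rewrite subr_ge0.
  - rewrite addr_ge0 ?sqr_ge0// !mulr_ge0//; rewrite /m; lra.
  - by rewrite !mulr_ge0// ?sqr_ge0// ltW.
  - have h : 0 <= (1 - x) ^+ 2 - 4 * x.
      have := mulr_ge0 (_ : 0 <= 17 / 100 - x) (_ : 0 <= 383/100 - x); rewrite !subr_ge0; nra.
    have := mulr_ge0 x0 h; have : 0 <= (m - x) * (1 - x) ^+ 2 by rewrite mulr_ge0 ?sqr_ge0// /m; lra.
    by lra.
rewrite pmulr_rge0 ?subr_ge0// in key.
by rewrite exprn_gt0//; lra.
Qed.

(** The logarithm of the likelihood factor of an unscanned observation in the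
    upward scan.  The two sides agree at [x = 0], and
    [sparse_derivative_bound] compares their derivatives. *)
Lemma sparse_exponent a x : 0 < a <= 1 -> 0 <= x <= 17 / 100 -> x < 1 - a ->
  x < expR (- (2 * a)) /\
  - (2 * a * (1 - a) / (1 - a - x)) <= ln ((expR (- (2 * a)) - x) / (1 - x)).
Proof.
move=> /andP[a0 a1] /andP[x0 x1] xa; set c := expR _.
have c1 : c < 1 by rewrite -[ltRHS]expR0 ltr_expR; lra.
have hc : (2 - a) ^+ 2 <= c * (2 + a) ^+ 2.
  have -> : c = (expR a ^+ 2)^-1 by rewrite -expRM_natl -expRN.
  rewrite mulrC ler_pdivlMr ?exprn_gt0 ?expR_gt0// -exprMn.
  rewrite ler_pXn2r ?nnegrE//; last 2 first.
  - by rewrite mulr_ge0 ?expR_ge0//; lra.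
  - by lra.
  by apply: expR_le_pade; rewrite ltW.
have db y : 0 <= y <= x ->
    (1 - c) * (1 - a - y) ^+ 2 <= 2 * a * (1 - a) * (1 - y) * (c - y).
  by move=> /andP[y0 yx]; apply: sparse_derivative_bound => //; lra.
have xc y : 0 <= y <= x -> 0 < c - y.
  move=> yx; have := db y yx; move/andP: yx => [y0 yx] h.
  have p : 0 < (1 - c) * (1 - a - y) ^+ 2.
    by rewrite mulr_gt0 ?subr_gt0// exprn_gt0//; lra.
  have := lt_le_trans p h; rewrite pmulr_rgt0// mulr_gt0 ?mulr_gt0//; lra.
split; first by rewrite -subr_gt0; apply: xc; rewrite x0 lexx.
pose f y := 2 * a * (1 - a) * (1 - a - y)^-1 + ln (c - y) - ln (1 - y).
pose df y := 2 * a * (1 - a) / (1 - a - y) ^+ 2 - (c - y)^-1 + (1 - y)^-1.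
have fdf y : 0 <= y <= x -> is_derive y 1 f (df y).
  move=> yx; have cy := xc y yx; move/andP: yx => [y0 yx].
  have ay : 0 < 1 - a - y by lra.
  have y1 : 0 < 1 - y by lra.
  have d1 : is_derive y 1 (@ln R \o (fun y => c - y)) ((c - y)^-1 * (- 1)).
    apply: is_derive1_comp; first exact: is_derive1_ln.
    by apply: is_derive_eq; rewrite /GRing.scale /=; ring.
  have d2 : is_derive y 1 (@ln R \o (fun y => 1 - y)) ((1 - y)^-1 * (- 1)).
    apply: is_derive1_comp; first exact: is_derive1_ln.
    by apply: is_derive_eq; rewrite /GRing.scale /=; ring.
  have ? : 1 - a - y != 0 by rewrite gt_eqF.
  rewrite /f; apply: is_derive_eq; rewrite /GRing.scale /= /df.
  by field; rewrite !gt_eqF.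
have df0 y : 0 <= y <= x -> 0 <= df y.
  move=> yx; have cy := xc y yx; have h := db y yx; move/andP: yx => [y0 yx].
  have ay : 0 < 1 - a - y by lra.
  have y1 : 0 < 1 - y by lra.
  have -> : df y = (2 * a * (1 - a) * (1 - y) * (c - y) - (1 - c) * (1 - a - y) ^+ 2)
     / ((1 - a - y) ^+ 2 * (c - y) * (1 - y)).
    by rewrite /df; field; rewrite !gt_eqF.
  by rewrite divr_ge0 ?subr_ge0// !mulr_ge0 ?sqr_ge0// ltW.
have f00 : f 0 = 0.
  by rewrite /f !subr0 expRK ln1; field; rewrite gt_eqF//; lra.
have := derive_ge0_le x0 fdf df0; rewrite f00 /f => h.
rewrite ln_div ?posrE; [lra| apply: xc; rewrite x0 lexx// | lra].
Qed.
End Calculus.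

(** * Independent letters and scanning of a chain of sets *)

Lemma ler_indicator {R : realType} (b c : bool) : (b -> c) -> b%:R <= c%:R :> R.
Proof. by case: b => [->|]. Qed.

Section Words.
Context {R : realType} (A : finType) (p : A -> R).
Hypothesis p_ge0 : forall a, 0 <= p a.
Hypothesis p_sum1 : \sum_a p a = 1.

Fixpoint expect n (f : seq A -> R) : R :=
  if n is n'.+1 then \sum_a p a * expect n' (fun s => f (a :: s)) else f [::].

Lemma expectS n f :
  expect n.+1 f = \sum_a p a * expect n (fun s => f (a :: s)).
Proof. by []. Qed.

Lemma expect_le n f g : (forall s, size s = n -> f s <= g s) ->
  expect n f <= expect n g.
Proof.
elim: n f g => [|n IH] f g fg /=; first exact: fg.
apply: ler_sum => a _; rewrite ler_wpM2l//; apply: IH => s sn.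
by apply: fg; rewrite /= sn.
Qed.

Lemma eq_expect n f g : (forall s, size s = n -> f s = g s) ->
  expect n f = expect n g.
Proof.
elim: n f g => [|n IH] f g fg /=; first exact: fg.
by apply: eq_bigr => a _; congr (_ * _); apply: IH => s sn; rewrite fg//= sn.
Qed.

Lemma expect_cst n c : expect n (fun=> c) = c.
Proof. by elim: n => //= n IH; rewrite IH -mulr_suml p_sum1 mul1r. Qed.

Lemma expectZ n c f : expect n (fun s => c * f s) = c * expect n f.
Proof.
elim: n f => //= n IH f; rewrite mulr_sumr; apply: eq_bigr => a _.
by rewrite IH mulrCA.
Qed.

Lemma expectD n f g :
  expect n (fun s => f s + g s) = expect n f + expect n g.
Proof.
elim: n f g => //= n IH f g; rewrite -big_split/=; apply: eq_bigr => a _.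
by rewrite IH mulrDr.
Qed.

Lemma expect_sum n (I : Type) (r : seq I) (F : I -> seq A -> R) :
  expect n (fun s => \sum_(i <- r) F i s) = \sum_(i <- r) expect n (F i).
Proof.
elim: r => [|i r IH].
  rewrite big_nil -[RHS](expect_cst n); apply: eq_expect => s _.
  by rewrite big_nil.
rewrite big_cons -IH -expectD; apply: eq_expect => s _; by rewrite big_cons.
Qed.

Lemma expect_ge0 n f : (forall s, 0 <= f s) -> 0 <= expect n f.
Proof. by move=> f0; rewrite -[leLHS](expect_cst n); apply: expect_le. Qed.

Definition mass (U : {set A}) := \sum_(a in U) p a.

Lemma mass_ge0 U : 0 <= mass U. Proof. exact: sumr_ge0. Qed.

Lemma mass_setC U : mass (~: U) = 1 - mass U.
Proof.
rewrite -p_sum1 (bigID (mem U))/= /mass addrC addrK.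
by apply: eq_bigl => a; rewrite inE.
Qed.

Lemma mass_le1 U : mass U <= 1.
Proof. by rewrite -subr_ge0 -mass_setC mass_ge0. Qed.

Lemma mass_setT : mass finset.setT = 1.
Proof. by rewrite -p_sum1; apply: eq_bigl => a; rewrite inE. Qed.

(** [f] does not distinguish the letters of [W]: it is measurable for what a
    scan has seen when [W] is the set still unscanned. *)
Definition blind (W : {set A}) (f : seq A -> R) :=
  forall s1 a b s2, a \in W -> b \in W -> f (s1 ++ a :: s2) = f (s1 ++ b :: s2).

Variable theta : R.

(** Density at [a] of a law tilted by the factor [1 - theta] outside [W], when
    the letters of [W] are not distinguished: the mean over all letters
    is 1. *)
Definition tilt (W : {set A}) a := 1 + theta * ((a \in W)%:R / mass W - 1).

Definition likelihood W s := \prod_(a <- s) tilt W a.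

Lemma likelihood_blind W : blind W (likelihood W).
Proof.
move=> s1 a b s2 aW bW; rewrite /likelihood !big_cat !big_cons /=.
by rewrite /tilt aW bW.
Qed.

Lemma sum_tilt (V W : {set A}) : V \subset W -> 0 < mass V ->
  \sum_(a in W) p a * tilt V a = (1 - theta) * mass W + theta.
Proof.
move=> VW V0.
have -> : \sum_(a in W) p a * tilt V a =
    \sum_(a in W) ((1 - theta) * p a + theta / mass V * (if a \in V then p a else 0)).
  apply: eq_bigr => a _; rewrite /tilt; case: ifP => _ /=;
  by field; rewrite gt_eqF.
rewrite big_split/= -!mulr_sumr -/(mass W) -big_mkcondr/=.
rewrite (eq_bigl (mem V)) => [|a]; last first.
  by rewrite andb_idl// => /(fintype.subsetP VW).
by rewrite -/(mass V) divfK ?gt_eqF.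
Qed.

(** The martingale property of the likelihood along a decreasing chain of
    unscanned sets: on [W] the tilts for [V] and for [W] have the same mean,
    and they agree outside [W]. *)
Lemma expect_likelihood_sub (V W : {set A}) f n : V \subset W -> 0 < mass V ->
  blind W f ->
  expect n (fun s => f s * likelihood W s) =
  expect n (fun s => f s * likelihood V s).
Proof.
move=> VW V0; have W0 : 0 < mass W.
  have -> : mass W = mass V + mass (W :\: V).
    by rewrite {1}/mass (finset.big_setID V)/= (finset.setIidPr VW).
  by rewrite ltr_wpDr// mass_ge0.
elim: n f => [f _|n IH f bf] /=; first by rewrite /likelihood !big_nil.
have step U a : expect n (fun s => f (a :: s) * likelihood U (a :: s)) =
    tilt U a * expect n (fun s => f (a :: s) * likelihood U s).
  by rewrite -expectZ; apply: eq_expect => s _; rewrite /likelihood big_cons mulrCA.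
pose g a := expect n (fun s => f (a :: s) * likelihood V s).
transitivity (\sum_a p a * (tilt W a * g a)).
  apply: eq_bigr => a _; rewrite step IH// => s1 b c s2 bW cW.
  exact: (bf (_ :: s1)).
transitivity (\sum_a p a * (tilt V a * g a)); last first.
  by apply: eq_bigr => a _; rewrite step.
rewrite (bigID (mem W))/= [RHS](bigID (mem W))/=; congr (_ + _); last first.
  apply: eq_bigr => a aW; rewrite /tilt (negbTE aW) (_ : (a \in V) = false)//.
  by rewrite !mul0r.
  by apply/negbTE; apply: contra aW => /(fintype.subsetP VW).
have [W0'|[a0 a0W]] := finset.set_0Vmem W.
  by exfalso; move: W0; rewrite W0' /mass finset.big_set0 ltxx.
have gE a : a \in W -> g a = g a0.
  move=> aW; apply: eq_expect => s _; congr (_ * _); exact: (bf [::]).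
transitivity (\sum_(a in W) p a * tilt W a * g a0).
  by apply: eq_bigr => a aW; rewrite gE// mulrA.
rewrite -mulr_suml sum_tilt//.
transitivity (\sum_(a in W) p a * tilt V a * g a0).
  by rewrite -mulr_suml sum_tilt.
by apply: eq_bigr => a aW; rewrite gE// mulrA.
Qed.

Lemma likelihood_ge0 W s : (forall a, 0 <= tilt W a) -> 0 <= likelihood W s.
Proof. by move=> h; apply: prodr_ge0. Qed.

Let nested (X Y : {set A}) := Y \subset X.

(** Doob's maximal inequality along the scan, in a form that allows an
    induction on the chain: [f] is the indicator that the likelihood has
    stayed below [c] so far. *)
Lemma scan_step c Ws W f n : 0 <= c ->
  (forall V, V \in W :: Ws -> 0 < mass V /\ forall a, 0 <= tilt V a) ->
  path nested W Ws -> blind W f -> (forall s, 0 <= f s) ->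
  c * expect n (fun s => f s * (has (fun V => c <= likelihood V s) Ws)%:R)
  <= expect n (fun s => f s * likelihood W s).
Proof.
move=> c0; elim: Ws W f => [|V Ws IH] W f hW.
  move=> _ _ f0; rewrite (_ : expect _ _ = 0); last first.
    by rewrite -[RHS](expect_cst n); apply: eq_expect => s _; rewrite /= mulr0.
  rewrite mulr0 expect_ge0// => s; rewrite mulr_ge0//; apply: likelihood_ge0.
  by apply: (hW W _).2; rewrite mem_head.
move=> /= /andP[VW pWs] bf f0.
have [V0 lV] : 0 < mass V /\ forall a, 0 <= tilt V a.
  by apply: hW; rewrite !inE eqxx orbT.
rewrite (expect_likelihood_sub _ VW V0 bf).
pose f' s := f s * (likelihood V s < c)%R%:R.
have bf' : blind V f'.
  move=> s1 a b s2 aV bV; rewrite /f' (likelihood_blind _ _ aV bV).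
  by rewrite (bf _ _ b)//; apply: (fintype.subsetP VW).
have f'0 s : 0 <= f' s by rewrite mulr_ge0.
have {}IH := IH V f' _ pWs bf' f'0.
apply: (@le_trans _ _ (expect n (fun s => f s * (c <= likelihood V s)%R%:R * c) +
   c * expect n (fun s => f' s * (has (fun V => c <= likelihood V s) Ws)%:R))).
  rewrite -!expectZ -expectD; apply: expect_le => s _.
  rewrite /f' /=; case: leP => /= _; last by rewrite !mulr0 mul0r add0r mulr1.
  by rewrite !(mulr1, mulr0, mul0r, addr0) mulrC.
apply: (@le_trans _ _ (expect n (fun s => f s * (c <= likelihood V s)%R%:R * c) +
   expect n (fun s => f' s * likelihood V s))).
  rewrite lerD2l IH// => U; rewrite inE => /predU1P[->//|UWs].
  by apply: hW; rewrite !inE UWs !orbT.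
rewrite -expectD; apply: expect_le => s _; rewrite /f' /=.
case: leP => /= h; last by rewrite !mulr0 mul0r add0r mulr1.
by rewrite !(mulr1, mulr0, mul0r, addr0) ler_wpM2l.
Qed.

Lemma scan_bound c Ws n : 0 < c ->
  (forall V, V \in Ws -> 0 < mass V /\ forall a, 0 <= tilt V a) ->
  sorted nested Ws ->
  expect n (fun s => (has (fun V => c <= likelihood V s) Ws)%:R) <= c^-1.
Proof.
move=> c0 hWs sWs; rewrite -[leRHS]mul1r ler_pdivlMr// mulrC.
have lT a : tilt finset.setT a = 1.
  by rewrite /tilt inE mass_setT divr1 subrr mulr0 addr0.
have := @scan_step c Ws finset.setT (fun=> 1) n (ltW c0) _ _ _ _.
under eq_expect do rewrite mul1r; move=> h; apply: le_trans (h _ _ _ _) _ => //.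
- move=> V; rewrite inE => /predU1P[->|]; last exact: hWs.
  by rewrite mass_setT; split => // a; rewrite lT.
- case: Ws sWs {hWs h} => //= V Ws ->; rewrite andbT; exact: finset.subsetT.
rewrite -[leRHS](expect_cst n); apply: expect_le => s _; rewrite mul1r.
by rewrite /likelihood big1.
Qed.

Lemma likelihoodE W s :
  likelihood W s = (1 - theta + theta / mass W) ^+ count [in W] s
                   * (1 - theta) ^+ (size s - count [in W] s).
Proof.
rewrite /likelihood; elim: s => [|a s IH]; first by rewrite big_nil !expr0 mulr1.
rewrite big_cons IH /= /tilt; case: (a \in W) => /=.
  rewrite add1n subSS exprS -mulrA; congr (_ * _); lra.
rewrite add0n subSn ?count_size// exprS mulrCA; congr (_ * (_ * _)); lra.
Qed.

End Words.

(** * Crossings at a fixed time *)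

Section Crossing.
Context {R : realType} (A : finType) (p : A -> R).
Hypothesis p_ge0 : forall a, 0 <= p a.
Hypothesis p_sum1 : \sum_a p a = 1.
Let nested (X Y : {set A}) := Y \subset X.

(** The centred count, on the scale of counts rather than of frequencies. *)
Definition excess (U : {set A}) (s : seq A) : R :=
  (count [in U] s)%:R - (size s)%:R * mass p U.

Lemma excess_le U s : excess U s <= (size s)%:R * (1 - mass p U).
Proof. by rewrite /excess mulrBr mulr1 lerB// ler_nat count_size. Qed.

Lemma excess_setC U s : excess (~: U) s = - excess U s.
Proof.
rewrite /excess mass_setC//.
have -> : count [in ~: U] s = (size s - count [in U] s)%N.
  rewrite -(count_predC [in U] s) addnC addnK.
  by apply: eq_count => a; rewrite !inE.
by rewrite natrB ?count_size//; ring.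
Qed.

(** One tilt, of log-odds [4 * a] at mass [g], serves the whole band.  If [x]
    denotes its log-odds at the mass [u], then by Hoeffding's lemma the
    log-likelihood at a crossing is at least
    [n * (x * a - x^2 / 8) = n * (2 * a^2 - (x - 4 * a)^2 / 8)]. *)
Lemma crossing_in_band d g a n (Us : seq {set A}) : 0 <= d < 1 -> 0 < g ->
  0 <= a -> sorted nested Us ->
  (forall U, U \in Us -> (1 - d) * mass p U <= g <= (1 + d) * mass p U) ->
  expect p n (fun s => (has (fun U => n%:R * a < excess U s) Us)%:R) <=
  expR (- (2 * (1 - d ^+ 2) * (n%:R * a ^+ 2))).
Proof.
move=> d01 g0 a0 sUs hUs.
pose sg := g * (expR (4 * a) - 1).
have sg0 : 0 <= sg.
  by rewrite mulr_ge0 ?(ltW g0)// subr_ge0 -[leLHS]expR0 ler_expR; lra.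
pose theta := sg / (1 + sg).
have sg1 : 0 < 1 + sg by lra.
have mU U : U \in Us -> 0 < mass p U.
  move=> /hUs /andP[_ h]; have /andP[d0 _] := d01.
  have : 0 < (1 + d) * mass p U by exact: lt_le_trans h.
  by rewrite pmulr_rgt0//; lra.
rewrite expRN.
apply: le_trans (scan_bound p_ge0 p_sum1 (theta := theta) n (expR_gt0 _) _ sUs); last first.
  move=> U UUs; have u0 := mU _ UUs; split => // b; rewrite /tilt.
  have -> : 1 + theta * ((b \in U)%:R / mass p U - 1)
    = (1 + sg)^-1 * (1 + sg * ((b \in U)%:R / mass p U)).
    by rewrite /theta; field; rewrite !gt_eqF.
  by rewrite mulr_ge0 ?invr_ge0 ?ltW// ltr_wpDr// mulr_ge0// divr_ge0// ltW.
apply: expect_le => // s sn; rewrite ler_nat.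
have [/hasP[U UUs hU]|//] := boolP (has _ _).
apply: (@leq_trans 1) => //; rewrite lt0b; apply/hasP; exists U => //.
have u0 := mU _ UUs; have u1 := mass_le1 p_ge0 p_sum1 U.
set u := mass p U in u0 u1 *.
have X0 : 0 < 1 + sg / u by rewrite ltr_wpDr// divr_ge0// ltW.
set x := ln (1 + sg / u).
have ex : expR x = 1 + sg / u by rewrite lnK ?posrE.
have x0 : 0 <= x by apply: ln_ge0; rewrite lerDl divr_ge0// ltW.
have hs := hoeffding_bernoulli (_ : 0 <= u <= 1) x0.
have {}hs : 1 + sg <= expR (u * x + x ^+ 2 / 8).
  have -> : 1 + sg = 1 - u + u * expR x by rewrite ex; field; rewrite gt_eqF.
  by apply: hs; rewrite ltW.
rewrite likelihoodE -/u sn.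
have -> : 1 - theta + theta / u = (1 + sg)^-1 * expR x.
  by rewrite ex /theta; field; rewrite !gt_eqF.
have -> : 1 - theta = (1 + sg)^-1 by rewrite /theta; field; rewrite !gt_eqF.
rewrite exprMn [X in _ <= X]mulrAC -exprD subnKC; last by rewrite -sn count_size.
rewrite exprVn -expRM_natl [X in _ <= X]mulrC ler_pdivlMr ?exprn_gt0//.
apply: (@le_trans _ _ (expR (2 * (1 - d ^+ 2) * (n%:R * a ^+ 2))
  * expR (n%:R * (u * x + x ^+ 2 / 8)))).
  rewrite ler_wpM2l ?expR_ge0// expRM_natl.
  by apply: lerXn2r => //; rewrite nnegrE ?expR_ge0// ltW.
rewrite -expRD ler_expR.
set N := count _ _.
have hN : n%:R * (a + u) <= N%:R.
  by move: hU; rewrite /excess -/N -/u sn mulrDr; lra.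
have xN := ler_wpM2r x0 hN.
have := @ln_tilt_near R d (4 * a) (g / u) d01.
have -> : 1 + g / u * (expR (4 * a) - 1) = 1 + sg / u by rewrite /sg; field; rewrite gt_eqF.
rewrite -/x => near.
have {}near : (x - 4 * a) ^+ 2 <= (d * (4 * a)) ^+ 2.
  apply: near; first by lra.
  by rewrite ler_pdivlMr// ler_pdivrMr// hUs.
have n0 : 0 <= n%:R :> R by [].
have := ler_wpM2l n0 near; nra.
Qed.

(** Sets of small mass, described by their complements [W], which decrease
    when the chain is scanned upwards.  The scanned letters get the density
    [expR (2 * a)] and few letters remain in [W] at a crossing, so
    [sparse_exponent] bounds the likelihood from below. *)
Lemma crossing_sparse a n (Ws : seq {set A}) : 0 < a <= 1 ->
  sorted nested Ws ->
  (forall W, W \in Ws -> 83 / 100 <= mass p W /\ a < mass p W) ->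
  expect p n (fun s => (has (fun W => n%:R * a < excess (~: W) s) Ws)%:R) <=
  expR (- (2 * (n%:R * a ^+ 2))).
Proof.
move=> a01 sWs hWs; have /andP[a0 a1] := a01.
pose theta := 1 - expR (2 * a); pose c := expR (- (2 * a)).
pose r w := (c - (1 - w)) / w.
have rP W : W \in Ws ->
    [/\ 0 < mass p W, 0 < r (mass p W), r (mass p W) <= 1 &
     - (2 * a * (1 - a)) <= (mass p W - a) * ln (r (mass p W))].
  move=> /hWs[w1 wa]; have w2 := mass_le1 p_ge0 p_sum1 W.
  set w := mass p W in w1 wa w2 *.
  have [||] := @sparse_exponent R a (1 - w) a01; [lra|lra|].
  rewrite -/c (_ : 1 - (1 - w) = w); last by ring.
  rewrite -/(r w) => h1 h2.
  have w0 : 0 < w by lra.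
  have r0 : 0 < r w by rewrite divr_gt0// subr_gt0.
  split => //.
    rewrite ler_pdivrMr// mul1r.
    have : c <= 1 by rewrite -[leRHS]expR0 ler_expR; lra.
    lra.
  have := ler_wpM2l (_ : 0 <= w - a) h2; rewrite subr_ge0 => /(_ (ltW wa)).
  rewrite (_ : (w - a) * - (2 * a * (1 - a) / (1 - a - (1 - w))) = - (2 * a * (1 - a)))//.
  by field; rewrite gt_eqF//; lra.
have lE W : W \in Ws -> 1 - theta + theta / mass p W = expR (2 * a) * r (mass p W).
  move=> /rP[w0 _ _ _]; rewrite /theta /r /c expRN; field.
  by rewrite !gt_eqF ?expR_gt0.
rewrite expRN.
apply: le_trans (scan_bound p_ge0 p_sum1 (theta := theta) n (expR_gt0 _) _ sWs); last first.
  move=> W WWs; have [w0 r0 _ _] := rP _ WWs; split => // b; rewrite /tilt.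
  case: (b \in W) => /=.
    have -> : 1 + theta * (1 / mass p W - 1) = 1 - theta + theta / mass p W by ring.
    by rewrite lE// mulr_ge0 ?expR_ge0 ?ltW.
  have -> : 1 + theta * (0 / mass p W - 1) = expR (2 * a) by rewrite /theta mul0r; ring.
  exact: expR_ge0.
apply: expect_le => // s sn; rewrite ler_nat.
have [/hasP[W WWs hW]|//] := boolP (has _ _).
apply: (@leq_trans 1) => //; rewrite lt0b; apply/hasP; exists W => //.
have [w0 r0 r1 hr] := rP _ WWs.
rewrite likelihoodE lE// sn; move: hW; rewrite excess_setC /excess sn.
set w := mass p W in w0 r0 r1 hr *; set N := count _ _ => hN.
have -> : 1 - theta = expR (2 * a) by rewrite /theta; ring.
rewrite exprMn [X in _ <= X]mulrAC -exprD subnKC; last by rewrite -sn count_size.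
rewrite -(lnK (_ : r w \is Num.pos)) ?posrE// -!expRM_natl -expRD ler_expR.
have l0 : ln (r w) <= 0 by apply: ln_le0.
have hN' : N%:R <= n%:R * (w - a) by rewrite mulrBr; lra.
have h1 := ler_wnM2r l0 hN'.
have h2 := ler_wpM2l (_ : 0 <= n%:R) hr.
have {}h2 := h2 (ler0n _ _).
lra.
Qed.

(** The bands have the ratio [(1 + d) / (1 - d)]; [K] of them reach from 17/100
    up to 1, and the sparse sets need one more term. *)
Lemma crossing_bound d K n a (Us : seq {set A}) : 0 <= d < 1 -> 0 < a ->
  1 <= 17 / 100 * ((1 + d) / (1 - d)) ^+ K -> sorted nested Us ->
  expect p n (fun s => (has (fun U => n%:R * a < excess U s) Us)%:R) <=
  K.+1%:R * expR (- (2 * (1 - d ^+ 2) * (n%:R * a ^+ 2))).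
Proof.
move=> d01 a0 hK sUs; have /andP[d0 d1] := d01.
have [a1|a1] := leP a 1; last first.
  rewrite (_ : expect _ _ _ = 0) ?mulr_ge0 ?expR_ge0//.
  rewrite -[RHS](expect_cst p_sum1 n); apply: eq_expect => // s sn.
  rewrite (_ : has _ _ = false)//; apply/negbTE/hasPn => U _; rewrite -leNgt.
  apply: le_trans (excess_le _ _) _; rewrite sn ler_wpM2l//.
  by have := mass_ge0 p_ge0 U; lra.
pose r := (1 + d) / (1 - d).
have r0 : 0 < r by rewrite divr_gt0//; lra.
pose g k : R := 17 / 100 * r ^+ k * (1 + d).
pose band k := [seq U <- Us | ((1 - d) * mass p U <= g k <= (1 + d) * mass p U)].
pose sparse := [seq U <- Us | (mass p U <= 17 / 100) && (a < 1 - mass p U)].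
have nested_trans : transitive nested.
  by move=> Y X Z XY YZ; exact: fintype.subset_trans YZ XY.
have cover s : size s = n ->
    (has (fun U => n%:R * a < excess U s) Us)%:R <=
    \sum_(0 <= k < K) (has (fun U => n%:R * a < excess U s) (band k))%:R
    + (has (fun U => n%:R * a < excess U s) sparse)%:R :> R.
  move=> sn; case: (boolP (has _ Us)) => [/hasP[U UUs hU]|_]; last first.
    by rewrite addr_ge0 ?sumr_ge0.
  have ua : a < 1 - mass p U.
    have := lt_le_trans hU (excess_le U s); rewrite sn.
    case: (posnP n) hU => [n0|n0 _]; last by rewrite ltr_pM2l// ltr0n.
    by rewrite /excess sn n0 !mul0r subr0; move/size0nil: (etrans sn n0) => ->; rewrite ltxx.
  have [u17|u17] := leP (mass p U) (17 / 100).
    rewrite [X in _ <= _ + X](_ : _ = 1) ?lerDr ?sumr_ge0//.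
    by rewrite (_ : has _ _ = true)//; apply/hasP; exists U; rewrite // mem_filter u17 ua.
  have ex : exists k, mass p U <= 17 / 100 * r ^+ k.
    by exists K; apply: le_trans hK; exact: mass_le1.
  case: (ex_minnP ex) => -[|k] hk kmin.
    by move: hk; rewrite expr0 mulr1 leNgt u17.
  have kK : (k < K)%N by apply: kmin; apply: le_trans hK; exact: mass_le1.
  have uk : 17 / 100 * r ^+ k < mass p U.
    by rewrite ltNge; apply/negP => /kmin; rewrite ltnn.
  have Ub : U \in band k.
    rewrite mem_filter UUs andbT; apply/andP; split; last first.
      by rewrite /g mulrC ler_pM2l ?ltW//; lra.
    have -> : g k = (1 - d) * (17 / 100 * r ^+ k.+1).
      by rewrite exprS /g {2}/r; field; rewrite gt_eqF// subr_gt0.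
    by rewrite ler_pM2l// subr_gt0.
  rewrite big_mkord (bigD1 (Ordinal kK))//= (_ : has _ (band k) = true); last first.
    by apply/hasP; exists U.
  by rewrite -addrA lerDl addr_ge0// sumr_ge0.
apply: le_trans (expect_le p_ge0 cover) _.
rewrite expectD expect_sum//.
rewrite -natr1 mulrDl mul1r lerD//.
  rewrite (_ : K%:R = \sum_(0 <= k < K) 1); last first.
    by rewrite big_const_nat iter_addr_0 subn0.
  rewrite mulr_suml; apply: ler_sum => k _; rewrite mul1r.
  apply: (@crossing_in_band d (g k)) => //.
  - by rewrite /g !mulr_gt0// ?exprn_gt0//; lra.
  - exact: ltW.
  - exact: sorted_filter.
  - by move=> U; rewrite mem_filter => /andP[].
have -> : expect p n (fun s => (has (fun U => n%:R * a < excess U s) sparse)%:R) =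
  expect p n (fun s => (has (fun W => n%:R * a < excess (~: W) s)
    [seq ~: U | U <- rev sparse])%:R).
  apply: eq_expect => // s _; rewrite has_map has_rev; congr (nat_of_bool _)%:R.
  by apply: eq_has => U /=; rewrite finset.setCK.
apply: le_trans (crossing_sparse n (_ : 0 < a <= 1) _ _) _.
- by rewrite a0.
- rewrite sorted_map rev_sorted /sparse.
  apply: (@sub_sorted _ nested); last exact: sorted_filter.
  by move=> X Y; rewrite /nested /= finset.setCS.
- move=> W /mapP[U]; rewrite mem_rev mem_filter => /andP[/andP[h1 h2] _] ->.
  by rewrite mass_setC//; split; lra.
rewrite ler_expR lerN2 ler_wpM2r ?mulr_ge0 ?sqr_ge0 ?(ltW a0)//.
by have := sqr_ge0 d; lra.
Qed.

End Crossing.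

(** * Crossings over a block of times *)

Section Maximal.
Context {R : realType} (A : finType) (p : A -> R).
Hypothesis p_ge0 : forall a, 0 <= p a.
Hypothesis p_sum1 : \sum_a p a = 1.
Let nested (X Y : {set A}) := Y \subset X.

Definition submartingale (V : seq A -> R) :=
  forall s, V s <= \sum_a p a * V (rcons s a).

Lemma submartingale_expect V n s0 : submartingale V ->
  V s0 <= expect p n (fun s => V (s0 ++ s)).
Proof.
move=> sV; elim: n s0 => [|n IH] s0 /=; first by rewrite cats0.
apply: le_trans (sV s0) _; apply: ler_sum => a _; rewrite ler_wpM2l//.
apply: le_trans (IH _) _; apply: expect_le => // s _; by rewrite cat_rcons.
Qed.

Lemma doob_maximal V c n : submartingale V -> (forall s, 0 <= V s) -> 0 <= c ->
  c * expect p n (fun s => (has (fun t => c <= V (take t s)) (iota 0 n.+1))%:R)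
  <= expect p n V.
Proof.
move=> sV V0 c0.
suff gen s0 : c * expect p n
    (fun s => (has (fun t => c <= V (s0 ++ take t s)) (iota 0 n.+1))%:R)
    <= expect p n (fun s => V (s0 ++ s)) by exact: (gen [::]).
elim: n s0 => [|n IH] s0.
  rewrite /= cats0 orbF; case: (leP c) => /= h; first by rewrite mulr1.
  by rewrite mulr0.
have [h|h] := leP c (V s0).
  apply: (@le_trans _ _ c); last exact: le_trans h (submartingale_expect _ _ sV).
  rewrite -[leRHS]mulr1 ler_wpM2l// -[leRHS](expect_cst p_sum1 n.+1).
  by apply: expect_le => // s _; rewrite lern1 leq_b1.
rewrite !expectS mulr_sumr; apply: ler_sum => a _.
rewrite mulrCA ler_wpM2l//; apply: le_trans (le_trans _ (IH (rcons s0 a))) _.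
  2: by apply: expect_le => // s _; rewrite cat_rcons.
rewrite ler_wpM2l//; apply: expect_le => // s _.
apply: ler_indicator => /hasP[t]; rewrite mem_iota; case: t => [|t] tn ct.
  by move: ct; rewrite take0 cats0 leNgt h.
apply/hasP; exists t; first by case/andP: tn => _; rewrite mem_iota !add0n ltnS.
by rewrite /= cat_rcons.
Qed.

Variable Us : seq {set A}.

(** The positive part of the maximal excess over [z]; the positive part
    keeps it nonnegative for an empty chain as well. *)
Definition overshoot z (s : seq A) : R :=
  \big[Num.max/0]_(U <- Us) (excess p U s - z).

Lemma overshoot_ge0 z s : 0 <= overshoot z s.
Proof. by rewrite /overshoot; elim/big_rec: _ => // U x _ x0; rewrite le_max x0 orbT. Qed.

Lemma overshoot_ge U z s : U \in Us -> excess p U s - z <= overshoot z s.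
Proof.
rewrite /overshoot; elim: Us => // V Vs IH; rewrite inE big_cons le_max.
by move=> /predU1P[->|/IH ->]; rewrite ?lexx ?orbT.
Qed.

Lemma overshoot_le z s y : 0 <= y ->
  (forall U, U \in Us -> excess p U s - z <= y) -> overshoot z s <= y.
Proof.
move=> y0 h; rewrite /overshoot big_seq; elim/big_rec: _ => // U x UUs xy.
by rewrite ge_max xy h.
Qed.

Lemma excess_rcons U s : excess p U s = \sum_a p a * excess p U (rcons s a).
Proof.
transitivity (\sum_a ((excess p U s - mass p U) * p a + (if a \in U then p a else 0))).
  by rewrite big_split/= -mulr_sumr p_sum1 -big_mkcond/= -/(mass p U); ring.
apply: eq_bigr => a _; rewrite /excess size_rcons -cats1 count_cat /= natrD.
by rewrite -natr1; case: (a \in U) => /=; ring.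
Qed.

Lemma overshoot_submartingale z : submartingale (overshoot z).
Proof.
move=> s; apply: overshoot_le => [|U UUs].
  by apply: sumr_ge0 => a _; rewrite mulr_ge0// overshoot_ge0.
have -> : excess p U s - z = \sum_a p a * (excess p U (rcons s a) - z).
  under eq_bigr do rewrite mulrBr.
  by rewrite sumrB -mulr_suml p_sum1 mul1r -excess_rcons.
by apply: ler_sum => a _; rewrite ler_wpM2l// overshoot_ge.
Qed.

(** Integration of an indicator by steps of length [h], which turns tail
    bounds into bounds on an expectation without integrals. *)
Lemma le_step_sum (h y : R) I : 0 <= h -> y <= h * I%:R ->
  y <= h * \sum_(0 <= i < I) (h * i%:R < y)%R%:R.
Proof.
move=> h0; elim: I => [|I IH] yI; first by rewrite big_nil.
have [hy|hy] := ltP (h * I%:R) y.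
  apply: le_trans yI _; rewrite ler_wpM2l//.
  rewrite (eq_big_nat _ _ (F2 := fun=> 1)).
    by rewrite big_const_nat iter_addr_0 subn0.
  move=> i; rewrite ltnS => /andP[_ iI].
  by rewrite (le_lt_trans _ hy)// ler_wpM2l// ler_nat.
apply: le_trans (IH hy) _; rewrite ler_wpM2l// big_nat_recr//= lerDl.
by rewrite ler0n.
Qed.

(** The integral of [expR (- g * y^2)] over [y >= z] is at most
    [expR (- g * z^2) / (2 * g * z)]; it is bounded by geometric sums whose
    step [h] tends to 0. *)
Lemma overshoot_tail d K n z g : 0 <= d < 1 -> 0 < z -> (0 < n)%N ->
  1 <= 17 / 100 * ((1 + d) / (1 - d)) ^+ K -> sorted nested Us ->
  g = 2 * (1 - d ^+ 2) / n%:R ->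
  expect p n (overshoot z) <= K.+1%:R * expR (- (g * z ^+ 2)) / (2 * g * z).
Proof.
move=> d01 z0 n0 hK sUs gE; have /andP[d0 d1] := d01.
have n0' : 0 < n%:R :> R by rewrite ltr0n.
have g0 : 0 < g by rewrite gE divr_gt0// mulr_gt0// subr_gt0 expr_lt1.
pose M := K.+1%:R * expR (- (g * z ^+ 2)).
have M0 : 0 < M by rewrite mulr_gt0 ?expR_gt0// ltr0n.
have step h : 0 < h -> expect p n (overshoot z) <= M / (2 * g * z) + M * h.
  move=> h0; pose I := (Num.truncn (n%:R / h)).+1.
  have nI : n%:R <= h * I%:R.
    rewrite mulrC -ler_pdivrMr// ltW//; apply: (truncnS_gt (n%:R / h)).
  have pt s : size s = n -> overshoot z s <= h * \sum_(0 <= i < I)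
      (has (fun U => z + h * i%:R < excess p U s) Us)%:R.
    move=> sn; apply: overshoot_le => [|U UUs].
      by rewrite mulr_ge0 ?(ltW h0)// sumr_ge0.
    have yI : excess p U s - z <= h * I%:R.
      apply: le_trans nI; have := excess_le p U s; rewrite sn => e1.
      have : n%:R * (1 - mass p U) <= n%:R * 1.
        by rewrite ler_wpM2l// lerBlDr lerDl mass_ge0.
      by lra.
    apply: le_trans (le_step_sum (ltW h0) yI) _; rewrite ler_wpM2l ?(ltW h0)//.
    apply: ler_sum => i _; apply: ler_indicator => hi.
    by apply/hasP; exists U => //; lra.
  apply: le_trans (expect_le p_ge0 pt) _; rewrite expectZ expect_sum//.
  pose q := expR (- (2 * g * z * h)).
  have v0 : 0 < 2 * g * z * h by rewrite !mulr_gt0.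
  have q1 : q < 1 by rewrite -[ltRHS]expR0 ltr_expR; lra.
  apply: (@le_trans _ _ (h * \sum_(0 <= i < I) M * q ^+ i)).
    rewrite ler_wpM2l ?(ltW h0)//; apply: ler_sum => i _.
    have zi : 0 < (z + h * i%:R) / n%:R.
      by rewrite divr_gt0// ltr_wpDr// mulr_ge0// ltW.
    have := crossing_bound p_ge0 p_sum1 n d01 zi hK sUs.
    rewrite mulrC divfK ?gt_eqF// => /le_trans; apply.
    rewrite /M /q -[X in _ <= X]mulrA ler_wpM2l// -expRM_natl -expRD ler_expR.
    have -> : 2 * (1 - d ^+ 2) * (n%:R * ((z + h * i%:R) / n%:R) ^+ 2)
      = g * (z + h * i%:R) ^+ 2 by rewrite gE; field; rewrite gt_eqF.
    have : 0 <= g * (h * i%:R) ^+ 2 by rewrite mulr_ge0 ?sqr_ge0// ltW.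
    lra.
  rewrite -mulr_sumr mulrCA.
  have -> : M / (2 * g * z) + M * h = M * ((2 * g * z)^-1 + h) by ring.
  rewrite ler_wpM2l ?(ltW M0)//.
  have gs : \sum_(0 <= i < I) q ^+ i <= (1 - q)^-1.
    rewrite -[leRHS]mul1r ler_pdivlMr ?subr_gt0// mulrC big_mkord.
    have -> : (1 - q) * \sum_(i < I) q ^+ i = 1 - q ^+ I.
      by have := subrX1 q I; lra.
    by rewrite gerBl exprn_ge0// expR_ge0.
  apply: le_trans (ler_wpM2l (ltW h0) gs) _.
  rewrite ler_pdivrMr ?subr_gt0//.
  set v := 2 * g * z * h in v0 *.
  have qv : q * (1 + v) <= 1.
    by rewrite -ler_pdivlMl ?expR_gt0// /q expRN invrK mulr1 expR_ge1Dx.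
  have -> : ((2 * g * z)^-1 + h) * (1 - q) = h * ((1 + v) * (1 - q) / v).
    by rewrite /v; field; rewrite !gt_eqF.
  rewrite -[leLHS]mulr1 ler_wpM2l ?(ltW h0)// ler_pdivlMr//; lra.
apply/ler_addgt0Pr => e e0.
have := step (e / M) (divr_gt0 e0 M0).
by rewrite [M * (_ / _)]mulrC divfK ?gt_eqF.
Qed.

(** Doob's inequality for the overshoot over [z := L * (1 - r)], with
    [r := 1 / (2 * G)].  This [r] is nearly optimal: lowering the level from
    [L] to [z] multiplies the tail by at most [expR (2 * G * r) = expR 1],
    which is why no power of [G] is lost. *)
Lemma epoch_crossing d K n L G : 0 <= d < 1 -> 0 < L -> (0 < n)%N ->
  1 <= 17 / 100 * ((1 + d) / (1 - d)) ^+ K -> sorted nested Us ->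
  G = 2 * (1 - d ^+ 2) * L ^+ 2 / n%:R -> 1 < 2 * G ->
  expect p n (fun s => (has (fun t => has (fun U => L <= excess p U (take t s)) Us)
    (iota 0 n.+1))%:R) <= K.+1%:R * expR (1 - G) / (1 - (2 * G)^-1).
Proof.
move=> d01 L0 n0 hK sUs GE' G1.
have n0' : 0 < n%:R :> R by rewrite ltr0n.
have G0 : 0 < G by lra.
pose r := (2 * G)^-1.
have r0 : 0 < r by rewrite invr_gt0 mulr_gt0.
have r1 : r < 1 by rewrite invf_lt1; lra.
have z0 : 0 < L * (1 - r) by rewrite mulr_gt0// subr_gt0.
have := doob_maximal n (overshoot_submartingale (L * (1 - r)))
  (overshoot_ge0 _) (ltW (mulr_gt0 L0 r0)).
move=> /le_trans /(_ (overshoot_tail d01 z0 n0 hK sUs erefl)) h.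
rewrite -(ler_pM2l (mulr_gt0 L0 r0)).
apply: le_trans (le_trans _ h) _.
  rewrite ler_pM2l ?mulr_gt0//; apply: expect_le => // s _.
  apply: ler_indicator => /hasP[t tn /hasP[U UUs LU]]; apply/hasP; exists t => //.
  by apply: le_trans (overshoot_ge _ _ UUs); lra.
set g := 2 * (1 - d ^+ 2) / n%:R.
have GE : G = g * L ^+ 2 by rewrite GE' /g; ring.
have g0 : 0 < g by move: G0; rewrite GE pmulr_lgt0// exprn_gt0.
have rE : 2 * g * L ^+ 2 * r = 1.
  have -> : 2 * g * L ^+ 2 * r = 2 * G * r by rewrite GE; ring.
  by rewrite /r mulfV// gt_eqF// mulr_gt0.
have -> : L * r * (K.+1%:R * expR (1 - G) / (1 - r)) =
   K.+1%:R * expR (1 - G) / (2 * g * (L * (1 - r))).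
  rewrite -[in LHS](mulr1 (L * r)) -[X in _ * X * _ = _](mulfV (_ : 2 * g * L ^+ 2 * r != 0)); last first.
    by rewrite rE oner_eq0.
  by rewrite {1}rE; field; rewrite !gt_eqF// subr_gt0.
have gz0 : 0 < 2 * g * (L * (1 - r)) by rewrite mulr_gt0// mulr_gt0.
rewrite ler_pM2r ?invr_gt0// ler_wpM2l// ler_expR.
have -> : g * (L * (1 - r)) ^+ 2 = G - (2 * g * L ^+ 2 * r) + G * r ^+ 2.
  by rewrite GE; ring.
by rewrite rE; have := mulr_ge0 (ltW G0) (sqr_ge0 r); lra.
Qed.

End Maximal.

(** * Words read off random letters *)

Section Letters.
Context {R : realType} {dT : measure_display} {T : measurableType dT}.
Variables (P : probability T R) (K : nat).
Variables (p : 'I_K -> R) (L : nat -> T -> 'I_K).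

Definition word n w := [seq L i w | i <- iota 0 n].

Lemma size_word n w : size (word n w) = n.
Proof. by rewrite size_map size_iota. Qed.

Lemma word_rcons n w : word n.+1 w = rcons (word n w) (L n w).
Proof. by rewrite /word -addn1 iotaD map_cat /= add0n cats1. Qed.

Lemma take_word t n w : (t <= n)%N -> take t (word n w) = word t w.
Proof. by move=> tn; rewrite /word -map_take take_iota (minn_idPl tn). Qed.

Hypothesis mL : forall i a, measurable [set w | L i w = a].
Hypothesis pL : forall s, P [set w | word (size s) w = s] = (\prod_(a <- s) p a)%:E.

(** The law of the word is the product law.  The induction goes from long
    prefixes to short ones, splitting an event according to the next
    letter. *)
Lemma word_event_prefix (Phi : seq 'I_K -> bool) k s :
  let E := [set w | word (size s) w = s /\ Phi (word (size s + k) w)] in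
  measurable E /\
  P E = (\prod_(a <- s) p a * expect p k (fun u => (Phi (s ++ u))%:R))%:E.
Proof.
elim: k s => [|k IH] s E.
  have mW : measurable [set w | word (size s) w = s].
    elim/last_ind: {E} s => [|s a IHs].
      by rewrite (_ : mkset _ = setT)//; apply/seteqP; split.
    rewrite (_ : mkset _ = [set w | word (size s) w = s] `&` [set w | L (size s) w = a]).
      exact: measurableI.
    apply/seteqP; split=> w /=; rewrite size_rcons word_rcons.
      by move=> /rcons_inj[-> ->].
    by move=> [-> ->].
  rewrite /= cats0; have -> : E = if Phi s then [set w | word (size s) w = s] else set0.
    apply/seteqP; split=> w; rewrite /E /= addn0.
      by move=> [ws]; rewrite ws => ->.
    by case: ifP => // Ps /= ws; rewrite ws.
  by case: (Phi s); rewrite ?mulr1 ?pL// mulr0 measure0.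
pose F i := [set w | val (L (size s) w) = i] `&` E.
have FE (i : 'I_K) : F i =
    [set w | word (size (rcons s i)) w = rcons s i /\
             Phi (word (size (rcons s i) + k) w)].
  apply/seteqP; split=> w; rewrite /F /E /= size_rcons word_rcons addSnnS.
    by move=> [/val_inj -> [-> ->]].
  by move=> [/rcons_inj[ws ->] ->].
have mF i : measurable (F i).
  have [iK|iK] := ltnP i K.
    by rewrite -[i]/(val (Ordinal iK)) FE; exact: (IH _).1.
  rewrite (_ : F i = set0)//; apply/seteqP; split=> w //= [Li _].
  by move: iK; rewrite -Li leqNgt /= ltn_ord.
have EF : E = \big[setU/set0]_(i < K) F i.
  rewrite -bigcup_mkord; apply/seteqP; split=> w.
    by move=> Ew; exists (L (size s) w) => //=; rewrite ?ltn_ord.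
  by move=> [i _ []].
split; first by rewrite EF; apply: bigsetU_measurable.
rewrite EF measure_bigsetU//; last first.
  apply/trivIsetP => i j _ _ ij; rewrite -subset0 => w [[/= e _] [/= e' _]].
  by move: ij; rewrite -e -e' eqxx.
rewrite expectS mulr_sumr -sumEFin; apply: eq_bigr => i _.
rewrite FE; apply: etrans (IH _).2 _; rewrite -cats1 big_cat big_seq1 -mulrA; congr (_ * (_ * _))%:E.
by apply: eq_expect => u _; rewrite -catA.
Qed.

End Letters.

(** * Chains of measurable sets *)

Section Chain.
Context {R : realType} {dT : measure_display} {T : measurableType dT}.
Context {dX : Order.disp_t} {X : orderType dX}.
Variables (P : probability T R) (Xs : nat -> T -> X).
Hypothesis Xs_iid : iid P Xs.

Definition law (B : set X) : R := fine (P (Xs 0%N @^-1` B)).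

Lemma ray_measurableC (B : set X) : ray_measurable B -> ray_measurable (~` B).
Proof. by rewrite -setTD; exact: sigma_algebraCD. Qed.

Lemma ray_measurable0 : ray_measurable (@set0 X).
Proof. by have [] := smallest_sigma_algebra [set: X] (@rays _ X). Qed.

Lemma ray_measurableT : ray_measurable [set: X].
Proof. by have := ray_measurableC ray_measurable0; rewrite setC0. Qed.

Lemma ray_measurableD (B C : set X) :
  ray_measurable B -> ray_measurable C -> ray_measurable (B `\` C).
Proof.
move=> mB mC; rewrite -[_ `\` _]setCK; apply: ray_measurableC.
rewrite setDE setCI setCK -bigcup2E.
have [_ _ U] := smallest_sigma_algebra [set: X] (@rays _ X); apply: U.
by move=> [|[|k]] /=; [exact: ray_measurableC| |exact: ray_measurable0].
Qed.

Lemma measurable_preimage i B : ray_measurable B -> measurable (Xs i @^-1` B).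
Proof. by have [m _ _] := Xs_iid; exact: m. Qed.

Lemma lawE i B : ray_measurable B -> P (Xs i @^-1` B) = (law B)%:E.
Proof.
move=> mB; have [_ id _] := Xs_iid; rewrite id// /law fineK//.
by apply: fin_num_measure; exact: measurable_preimage.
Qed.

Variables (D : nat -> set X) (M : nat).
Hypothesis D_nd : forall j k x, (j <= k)%N -> D j x -> D k x.
Hypothesis D_meas : forall j, ray_measurable (D j).

(** The position of an observation relative to the chain: the first [D j]
    containing it, or [M.+1] if there is none. *)
Definition letter x : 'I_M.+2 := inord (find (fun j => x \in D j) (iota 0 M.+1)).

Lemma letter_le x j : (j <= M)%N -> (letter x <= j)%N = (x \in D j).
Proof.
move=> jM; set s := iota 0 M.+1; rewrite /letter inordK; last first.
  by rewrite ltnS (leq_trans (find_size _ _))// size_iota.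
apply/idP/idP => [fj|Dj].
  have fs : (find (fun j => x \in D j) s < size s)%N by rewrite size_iota (leq_ltn_trans fj).
  have := nth_find 0%N (s := s) (a := fun j => x \in D j).
  rewrite has_find fs nth_iota ?size_iota// => [|]; last by move: fs; rewrite size_iota.
  by rewrite add0n !inE => /(_ isT); exact: D_nd.
rewrite leqNgt; apply/negP => /(before_find 0%N).
by rewrite nth_iota// add0n Dj.
Qed.

Let cell a := [set x | letter x = a].

Let cell_measurable a : ray_measurable (cell a).
Proof.
have le_meas (j : nat) : ray_measurable [set x | (letter x <= j)%N].
  have [jM|jM] := leqP j M.
    rewrite (_ : mkset _ = D j)//.
    by apply/seteqP; split=> x /=; rewrite letter_le// inE.
  rewrite (_ : mkset _ = setT); first exact: ray_measurableT.
  by apply/seteqP; split=> x //= _; rewrite (leq_trans _ jM)// -ltnS ltn_ord.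
have -> : cell a = [set x | (letter x <= a)%N] `\`
    (if (a : nat) is k.+1 then [set x | (letter x <= k)%N] else set0).
  apply/seteqP; split=> x /=.
    rewrite /cell /= => xa; split; first by rewrite xa.
    case E : (nat_of_ord a) => [|k]; first by move=> h; exact: h.
    by move=> /=; rewrite xa E ltnn.
  move=> [la na]; apply/val_inj/eqP; rewrite eqn_leq la /=.
  by case: (nat_of_ord a) na => //= k /negP; rewrite -ltnNge.
by apply: ray_measurableD => //; case: (nat_of_ord a) => // *; exact: ray_measurable0.
Qed.

Let p a := law (cell a).

Let letters i w := letter (Xs i w).

Let letters_meas i a : measurable [set w | letters i w = a].
Proof. exact: (measurable_preimage i (cell_measurable a)). Qed.

Let letters_law s : P [set w | word letters (size s) w = s] = (\prod_(a <- s) p a)%:E.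
Proof.
have [_ _ ind] := Xs_iid.
pose J := [fset i in iota 0 (size s)]%fset.
have := ind J (fun i => cell (nth ord0 s i)) (fun i _ => cell_measurable _).
rewrite (_ : \bigcap_(i in _) _ = [set w | word letters (size s) w = s]); last first.
  apply/seteqP; split=> w /=.
    move=> h; apply: (@eq_from_nth _ ord0); rewrite size_word// => i si.
    rewrite (nth_map 0%N) ?size_iota// nth_iota// add0n.
    by apply: h; rewrite /= !inE mem_iota.
  move=> ws i; rewrite /= !inE mem_iota /= add0n => si.
  by rewrite -[in nth _ _]ws (nth_map 0%N) ?size_iota// nth_iota.
move=> ->; rewrite (perm_big (iota 0 (size s))); last first.
  by apply: uniq_perm; rewrite ?fset_uniq ?iota_uniq// => i; rewrite !inE.
under eq_bigr do rewrite lawE//.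
by rewrite prodEFin (big_nth ord0) /index_iota subn0.
Qed.

Let p_ge0 a : 0 <= p a. Proof. exact/fine_ge0/measure_ge0. Qed.

Let word_event n (Phi : seq 'I_M.+2 -> bool) :
  measurable [set w | Phi (word letters n w)] /\
  P [set w | Phi (word letters n w)] = (expect p n (fun u => (Phi u)%:R))%:E.
Proof.
have [m e] := word_event_prefix letters_meas letters_law Phi n [::].
have eE : [set w | word letters (size (Nil 'I_M.+2)) w = [::] /\
    Phi (word letters (size (Nil 'I_M.+2) + n) w)] = [set w | Phi (word letters n w)].
  by apply/seteqP; split=> w //= [].
by rewrite -eE; split => //; rewrite e big_nil mul1r.
Qed.

Let p_sum1 : \sum_a p a = 1.
Proof.
have [_] := word_event 1 xpredT.
rewrite (_ : mkset _ = setT); last by apply/seteqP; split.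
by rewrite probability_setT /=; under eq_bigr do rewrite mulr1; move=> [].
Qed.

Let ball j := [set a : 'I_M.+2 | (a <= j)%N]%SET.

Let mass_ball j : (j <= M)%N -> mass p (ball j) = law (D j).
Proof.
move=> jM; have [_] := word_event 1 (fun s => head ord0 s \in ball j).
rewrite (_ : mkset _ = Xs 0%N @^-1` D j); last first.
  by apply/seteqP; split=> w /=; rewrite inE letter_le// inE.
rewrite lawE// => -[->]; rewrite /= /mass big_mkcond/=.
by apply: eq_bigr => a _; case: ifP; rewrite ?mulr1 ?mulr0.
Qed.

Definition chain_event n c := [set w | exists t j, [/\ (t <= n)%N, (j <= M)%N &
  c <= \sum_(i < t) (Xs i w \in D j)%:R - t%:R * law (D j)]].

Lemma chain_crossing d K n c G : 0 <= d < 1 -> 0 < c -> (0 < n)%N ->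
  1 <= 17 / 100 * ((1 + d) / (1 - d)) ^+ K ->
  G = 2 * (1 - d ^+ 2) * c ^+ 2 / n%:R -> 1 < 2 * G ->
  measurable (chain_event n c) /\
  (P (chain_event n c) <= (K.+1%:R * expR (1 - G) / (1 - (2 * G)^-1))%:E)%E.
Proof.
move=> d01 c0 n0 hK GE G1.
pose Us := [seq ball j | j <- rev (iota 0 M.+1)].
pose Phi s := has (fun t => has (fun U => c <= excess p U (take t s)) Us) (iota 0 n.+1).
have EE : chain_event n c = [set w | Phi (word letters n w)].
  have excE t j w : (t <= n)%N -> (j <= M)%N ->
      excess p (ball j) (take t (word letters n w)) =
      \sum_(i < t) (Xs i w \in D j)%:R - t%:R * law (D j).
    move=> tn jM; rewrite take_word// /excess size_word mass_ball//; congr (_ - _).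
    rewrite -(big_mkord xpredT (fun i => (Xs i w \in D j)%:R)) count_map.
    rewrite -sum1_count natr_sum big_mkcond /= /index_iota subn0.
    apply: eq_bigr => i _; rewrite inE /letters letter_le//.
    by case: (_ \in _).
  apply/seteqP; split=> w /=.
    move=> [t [j [tn jM h]]]; apply/hasP; exists t; first by rewrite mem_iota.
    apply/hasP; exists (ball j); last by rewrite excE.
    by apply: map_f; rewrite mem_rev mem_iota.
  move=> /hasP[t]; rewrite mem_iota /= add0n ltnS => tn /hasP[U /mapP[j]].
  rewrite mem_rev mem_iota /= add0n ltnS => jM ->; rewrite excE// => h.
  by exists t, j.
have [mE PE] := word_event n Phi.
rewrite EE; split => //; rewrite PE lee_fin.
apply: (epoch_crossing p_ge0 p_sum1 d01 c0 n0 hK _ GE G1).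
rewrite sorted_map rev_sorted; apply: (@sub_sorted _ ltn); last exact: iota_ltn_sorted.
move=> j k /= jk; apply/fintype.subsetP => a; rewrite !inE => /leq_trans; apply.
exact: ltnW.
Qed.

End Chain.

(** * Bracketing of the distribution function *)

Section Brackets.
Context {R : realType} {dT : measure_display} {T : measurableType dT}.
Context {dX : Order.disp_t} {X : orderType dX}.
Variables (P : probability T R) (Xs : nat -> T -> X).
Hypothesis X_complete : order_complete X.
Hypothesis Xs_iid : iid P Xs.
Hypothesis Xs_regular : order_regular P (Xs 0%N).

Definition lower_set (D : set X) := forall x y, D y -> (x <= y)%O -> D x.

(** Completeness makes every lower set a ray, the empty set or everything. *)
Lemma lower_set_measurable D : lower_set D -> ray_measurable D.
Proof.
move=> lD; have [->|D0] := eqVneq D set0; first exact: ray_measurable0.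
have /set0P [d0 Dd0] := D0.
have [ubD|nub] := pselect (has_ubound D); last first.
  rewrite (_ : D = setT); first exact: ray_measurableT.
  apply/seteqP; split=> // x _; apply: contrapT => nDx; apply: nub; exists x => y Dy.
  by rewrite leNgt; apply/negP => /ltW /(lD _ _ Dy).
have [s [us ls]] : supremums D !=set0 by apply: X_complete; split => //; exists d0.
apply: sub_sigma_algebra; exists s.
have [Ds|nDs] := pselect (D s); [left|right]; apply/seteqP; split=> x /=.
- exact: us.
- exact: lD.
- move=> Dx; rewrite lt_neqAle us// andbT; apply/eqP => xs; apply: nDs.
  by rewrite -xs.
- move=> xs; apply: contrapT => nDx; have : (s <= x)%O.
    by apply: ls => y Dy; rewrite leNgt; apply/negP => /ltW /(lD _ _ Dy).
  by rewrite leNgt xs.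
Qed.

Let F := order_cdf P (Xs 0%N).
Local Notation mu := (law P Xs).

Lemma le_ray_measurable (x : X) : ray_measurable [set y : X | (y <= x)%O].
Proof. by apply: sub_sigma_algebra; exists x; left. Qed.

Lemma ge_ray_measurable (x : X) : ray_measurable [set y : X | (x <= y)%O].
Proof.
rewrite (_ : mkset _ = ~` [set y : X | (y < x)%O]).
  by apply: ray_measurableC; apply: sub_sigma_algebra; exists x; right.
by apply/seteqP; split=> y /=; rewrite leNgt => /negP.
Qed.

Lemma law_le B C : ray_measurable B -> ray_measurable C -> B `<=` C ->
  mu B <= mu C.
Proof.
move=> mB mC BC; rewrite -lee_fin -!(lawE Xs_iid 0%N)//.
by apply: le_measure; [rewrite inE; exact: (measurable_preimage Xs_iid)|
  rewrite inE; exact: (measurable_preimage Xs_iid)|exact: preimage_subset].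
Qed.

Lemma law_setC B : ray_measurable B -> mu (~` B) = 1 - mu B.
Proof.
move=> mB; apply: EFin_inj; rewrite EFinB -!(lawE Xs_iid 0%N)//; last exact: ray_measurableC.
by rewrite preimage_setC probability_setC//; exact: (measurable_preimage Xs_iid).
Qed.

Lemma law_ge0 B : 0 <= mu B. Proof. exact/fine_ge0/measure_ge0. Qed.

Lemma law0 : mu set0 = 0.
Proof. by rewrite /law preimage_set0 measure0. Qed.

Lemma cdfE x : F x = mu [set y | (y <= x)%O]. Proof. by []. Qed.

Lemma cdf_le1 x : F x <= 1.
Proof.
rewrite cdfE -subr_ge0 -law_setC ?law_ge0//; exact: le_ray_measurable.
Qed.

(** A lower set is exhausted, in probability, by the rays below its points. *)
Lemma law_lower_gt D b : lower_set D -> 0 <= b -> b < mu D ->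
  exists2 x, D x & b < F x.
Proof.
move=> lD b0 bD; have D0 : D !=set0.
  by apply/set0P/eqP => D0; move: bD; rewrite D0 law0 ltNge b0.
have [rl _] := Xs_regular; have := rl D D0 lD.
rewrite (lawE Xs_iid 0%N) => [e|]; last exact: lower_set_measurable.
have : (b%:E < ereal_sup [set P [set w | (Xs 0%N w <= x)%O] | x in D])%E.
  by rewrite -e lte_fin.
move=> /ereal_sup_gt[_ [x Dx <-] bx]; exists x => //.
by move: bx; rewrite (lawE Xs_iid 0%N (le_ray_measurable x)) lte_fin.
Qed.

(** The lower quantile cuts at the level [q].  They differ by the quantile
    itself, so that [below q] has probability at most [q] and [atmost q] at
    least [q] even at an atom. *)
Definition below q := [set x | F x < q].
Definition atmost q := [set x | forall y, q <= F y -> (x <= y)%O].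

Lemma lower_below q : lower_set (below q).
Proof.
move=> x y; rewrite /below /= => yq xy; apply: le_lt_trans yq; rewrite !cdfE.
apply: law_le; try exact: le_ray_measurable.
by move=> z /= zx; exact: le_trans zx xy.
Qed.

Lemma lower_atmost q : lower_set (atmost q).
Proof. by move=> x y ym xy z qz; exact: le_trans xy (ym z qz). Qed.

Lemma law_below q : 0 <= q -> mu (below q) <= q.
Proof.
move=> q0; rewrite leNgt; apply/negP => h.
have [x] := law_lower_gt (@lower_below q) q0 h.
by rewrite /below /= => h1 /(lt_trans h1); rewrite ltxx.
Qed.

(** A point outside [atmost q] is strictly above some [y] with [q <= F y], so
    all upper rays starting outside [atmost q] have probability at most
    [1 - q]; regularity extends this to their union. *)
Lemma law_atmost q : q <= 1 -> q <= mu (atmost q).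
Proof.
move=> q1; have mA := lower_set_measurable (@lower_atmost q).
have -> : mu (atmost q) = 1 - mu (~` atmost q) by rewrite law_setC//; ring.
suff : mu (~` atmost q) <= 1 - q by lra.
have [A0|A0] := eqVneq (~` atmost q) set0; first by rewrite A0 law0 subr_ge0.
have [_ ru] := Xs_regular; have := ru (~` atmost q).
rewrite (lawE Xs_iid 0%N (ray_measurableC mA)) => e.
rewrite -lee_fin e; [|exact/set0P|].
- apply: ge_ereal_sup => _ [x /= nx <-].
  have [y [qy yx]] : exists y, q <= F y /\ (y < x)%O.
    apply: contrapT => h; apply: nx => y qy; rewrite leNgt; apply/negP => yx.
    by apply: h; exists y.
  rewrite (lawE Xs_iid 0%N (ge_ray_measurable x)) lee_fin.
  apply: (@le_trans _ _ (1 - F y)); last by lra.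
  rewrite cdfE -law_setC; last exact: le_ray_measurable.
  apply: law_le; [exact: ge_ray_measurable|apply: ray_measurableC; exact: le_ray_measurable|].
  by move=> z /= xz; apply/negP; rewrite -ltNge (lt_le_trans yx).
- move=> x y /= ny yx xm; apply: ny; exact: lower_atmost yx.
Qed.

Definition frequency t w (B : set X) : R := t%:R^-1 * \sum_(i < t) (Xs i w \in B)%:R.

Lemma empirical_cdfE t w x : empirical_cdf Xs t w x = frequency t w [set y | (y <= x)%O].
Proof.
rewrite /empirical_cdf /frequency; congr (_ * _); apply: eq_bigr => i _.
by congr (nat_of_bool _)%:R; apply/idP/idP; rewrite inE.
Qed.

Lemma frequency_le t w B C : B `<=` C -> frequency t w B <= frequency t w C.
Proof.
move=> BC; rewrite ler_wpM2l ?invr_ge0//; apply: ler_sum => i _.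
by apply: ler_indicator; rewrite !inE; exact: BC.
Qed.

Lemma frequency_setC t w B : (0 < t)%N -> frequency t w (~` B) = 1 - frequency t w B.
Proof.
move=> t0; rewrite /frequency -[X in X - _](mulVf (_ : t%:R != 0 :> R)); last first.
  by rewrite pnatr_eq0 -lt0n.
rewrite -mulrBr; congr (_ * _).
have -> : t%:R = \sum_(i < t) 1 :> R by rewrite sumr_const card_ord.
rewrite -sumrB; apply: eq_bigr => i _; rewrite in_setC.
by case: (_ \in _); rewrite /= ?subrr ?subr0.
Qed.

Lemma deviation_gtP t w b : (b%:E < cdf_deviation P Xs t w)%E <->
  exists x, b < `|frequency t w [set y | (y <= x)%O] - F x|.
Proof.
split.
  move=> /ereal_sup_gt[_ [x _ <-]]; rewrite lte_fin => h; exists x.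
  by rewrite -empirical_cdfE.
move=> [x bx]; apply: (@lt_le_trans _ _ (`|(empirical_cdf Xs t w \- F) x|)%:E).
  by rewrite lte_fin /= empirical_cdfE.
by apply: ereal_sup_ubound; exists x.
Qed.

Definition up_chain K j := below (j%:R / K%:R).
(** Complements, in the reversed order, so that deviations below [F] become
    positive excesses along an increasing chain. *)
Definition down_chain K j := ~` atmost ((K - j)%N%:R / K%:R).

Lemma up_chain_measurable K j : ray_measurable (up_chain K j).
Proof. apply: lower_set_measurable; exact: lower_below. Qed.

Lemma down_chain_measurable K j : ray_measurable (down_chain K j).
Proof. apply: ray_measurableC; apply: lower_set_measurable; exact: lower_atmost. Qed.

Lemma up_chain_nd K j k x : (j <= k)%N -> up_chain K j x -> up_chain K k x.
Proof.
move=> jk; rewrite /up_chain /below /= => /lt_le_trans; apply.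
by rewrite ler_wpM2r ?invr_ge0// ler_nat.
Qed.

Lemma down_chain_nd K j k x : (j <= k)%N -> down_chain K j x -> down_chain K k x.
Proof.
move=> jk; apply: contra_not => h y qy; apply: h; apply: le_trans qy.
by rewrite ler_wpM2r ?invr_ge0// ler_nat leq_sub2l.
Qed.

(** If [i] is the integral part of [K * F x], then [x] lies in the set [below]
    of level [(i + 1) / K], while the set [atmost] of level [i / K] consists of
    points up to [x].  The probabilities of both sets are within [1 / K] of
    [F x] on the relevant side. *)
Lemma bracket K t w b : (0 < K)%N -> (0 < t)%N ->
  ((b + K%:R^-1)%:E < cdf_deviation P Xs t w)%E ->
  exists2 j, (j <= K.+1)%N &
    b < frequency t w (up_chain K j) - mu (up_chain K j) \/
    b < frequency t w (down_chain K j) - mu (down_chain K j).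
Proof.
move=> K0 t0 /deviation_gtP[x]; set f := frequency _ _ _.
have K0' : 0 < K%:R :> R by rewrite ltr0n.
have Fx0 : 0 <= F x by rewrite cdfE law_ge0.
have KF : 0 <= K%:R * F x by rewrite mulr_ge0.
pose i := Num.truncn (K%:R * F x).
have /andP[i1 i2] := truncn_itv KF; rewrite -/i in i1 i2.
have {}i1 : i%:R / K%:R <= F x by rewrite ler_pdivrMr// mulrC.
have {}i2 : F x < i.+1%:R / K%:R by rewrite ltr_pdivlMr// mulrC.
have iK : (i <= K)%N.
  rewrite -(ler_nat R) -(ler_pM2r (_ : 0 < K%:R^-1)) ?invr_gt0//.
  by rewrite mulfV ?gt_eqF//; exact: le_trans i1 (cdf_le1 x).
have Ki : i.+1%:R / K%:R = i%:R / K%:R + K%:R^-1 :> R by rewrite -natr1 mulrDl mul1r.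
have [h|h] := leP 0 (f - F x).
  rewrite ger0_norm// => bf; exists i.+1 => //; left.
  have : f <= frequency t w (up_chain K i.+1).
    by apply: frequency_le => y /= yx; exact: lower_below yx.
  have : mu (up_chain K i.+1) <= i.+1%:R / K%:R.
    by apply: law_below; rewrite divr_ge0.
  lra.
rewrite ltr0_norm// => bf; exists (K - i)%N; first by rewrite (leq_trans (leq_subr _ _)).
right; rewrite /down_chain subKn//.
rewrite frequency_setC// law_setC; last by apply: lower_set_measurable; exact: lower_atmost.
have : frequency t w (atmost (i%:R / K%:R)) <= f.
  by apply: frequency_le => y /=; apply.
have := law_atmost (le_trans i1 (cdf_le1 x)).
lra.
Qed.

(** A deviation on a lower set is attained on a ray: the probability of a ray
    inside [D] is not larger, and the ray can be chosen to contain all the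
    observations lying in [D]. *)
Lemma lower_deviation t w b D : lower_set D -> 0 <= b ->
  b < frequency t w D - mu D -> (b%:E < cdf_deviation P Xs t w)%E.
Proof.
move=> lD b0 h; apply/deviation_gtP.
have freq0 : frequency t w set0 = 0.
  by rewrite /frequency big1 ?mulr0// => i _; rewrite in_set0.
have [D0|D0] := eqVneq D set0.
  by move: h; rewrite D0 law0 freq0 subr0 ltNge b0.
have /set0P[d0 Dd0] := D0.
(* Past the last observation lying in D, the empirical frequency of D is
   already that of a ray. *)
have [y Dy yP] : exists2 y, D y & forall i, (i < t)%N -> D (Xs i w) -> (Xs i w <= y)%O.
  elim: (t) => [|n [y Dy yP]]; first by exists d0.
  have [Dn|nDn] := pselect (D (Xs n w)); last first.
    by exists y => // i; rewrite ltnS leq_eqVlt => /predU1P[->|/yP].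
  have [yn|yn] := leP y (Xs n w).
    exists (Xs n w) => // i; rewrite ltnS leq_eqVlt => /predU1P[->//|/yP h1 /h1 h2].
    exact: le_trans h2 yn.
  exists y => // i; rewrite ltnS leq_eqVlt => /predU1P[-> _|/yP//].
  exact: ltW.
exists y; apply: lt_le_trans (ler_norm _); apply: lt_le_trans h _; apply: lerB.
  rewrite ler_wpM2l ?invr_ge0//; apply: ler_sum => i _.
  by apply: ler_indicator; rewrite !inE => Di; exact: yP.
rewrite cdfE; apply: law_le; [exact: le_ray_measurable|exact: lower_set_measurable|].
by move=> z /= zy; exact: lD Dy zy.
Qed.

(** A lower set is approximated in probability by its rays, which contain no
    more observations than it does. *)
Lemma upper_deviation t w b D : lower_set D -> 0 <= b -> (0 < t)%N ->
  b < frequency t w (~` D) - mu (~` D) -> (b%:E < cdf_deviation P Xs t w)%E.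
Proof.
move=> lD b0 t0; rewrite frequency_setC// law_setC; last exact: lower_set_measurable.
move=> h; apply/deviation_gtP.
have f0 : 0 <= frequency t w D by rewrite mulr_ge0 ?invr_ge0// sumr_ge0.
have [||x Dx bx] := @law_lower_gt D (b + frequency t w D) lD; [lra|lra|].
exists x; rewrite distrC; apply: lt_le_trans (ler_norm _).
have : frequency t w [set y | (y <= x)%O] <= frequency t w D.
  by apply: frequency_le => y /= yx; exact: lD Dx yx.
lra.
Qed.

Lemma frequency_measurable t b B : ray_measurable B ->
  measurable [set w | b < frequency t w B - mu B].
Proof.
move=> mB; rewrite (_ : mkset _ = (fun w => frequency t w B) @^-1` `]b + mu B, +oo[).
  have mf : measurable_fun setT (fun w => frequency t w B).
    apply: (measurableT_comp (mulrl_measurable _)); apply: measurable_sum => i.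
    exact: (measurable_indic (measurable_preimage Xs_iid i mB)).
  rewrite -[X in measurable X]setTI; apply: mf => //; exact: measurable_itv.
by apply/seteqP; split=> w /=; rewrite in_itv /= andbT ltrBrDr.
Qed.

(** The supremum over all points is the supremum over the countably many sets
    of all the chains. *)
Lemma deviation_measurable t b : (0 < t)%N -> 0 <= b ->
  measurable [set w | (b%:E < cdf_deviation P Xs t w)%E].
Proof.
move=> t0 b0.
pose up K j := [set w | b < frequency t w (up_chain K j) - mu (up_chain K j)].
pose dn K j := [set w | b < frequency t w (down_chain K j) - mu (down_chain K j)].
rewrite (_ : mkset _ = \bigcup_K \bigcup_j (up K j `|` dn K j)).
  apply: bigcup_measurable => K _; apply: bigcup_measurable => j _.
  apply: measurableU; apply: frequency_measurable.
    exact: up_chain_measurable.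
  exact: down_chain_measurable.
apply/seteqP; split=> w /=; last first.
  move=> [K _ [j _ [|]]] h.
    exact: lower_deviation (@lower_below _) b0 h.
  exact: upper_deviation (@lower_atmost _) b0 t0 h.
move=> /deviation_gtP[x bx].
pose e := `|frequency t w [set y | (y <= x)%O] - F x| - b.
have e0 : 0 < e by rewrite subr_gt0.
pose K := (Num.truncn e^-1).+1.
have Ke : K%:R^-1 < e.
  by rewrite invf_plt ?posrE// ?truncnS_gt.
have := @bracket K t w b isT t0; case.
  apply/deviation_gtP; exists x; rewrite -/e.
  by move: Ke; rewrite /e; lra.
by move=> j _ h; exists K => //; exists j.
Qed.

End Brackets.

(** * Exceedances over a block of times *)

Section Epochs.
Context {R : realType} {dT : measure_display} {T : measurableType dT}.
Context {dX : Order.disp_t} {X : orderType dX}.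
Variables (P : probability T R) (Xs : nat -> T -> X).
Hypothesis X_complete : order_complete X.
Hypothesis Xs_iid : iid P Xs.
Hypothesis Xs_regular : order_regular P (Xs 0%N).

Definition exceedance (Q : nat -> Prop) (b : nat -> R) :=
  [set w | exists t, Q t /\ ((b t)%:E < cdf_deviation P Xs t w)%E].

Lemma exceedance_measurable (Q : nat -> Prop) (b : nat -> R) :
  (forall t, Q t -> (0 < t)%N /\ 0 <= b t) -> measurable (exceedance Q b).
Proof.
move=> hQ.
rewrite (_ : exceedance Q b =
    \bigcup_(t in Q) [set w | ((b t)%:E < cdf_deviation P Xs t w)%E]).
  apply: bigcup_measurable => t /hQ[t0 b0].
  exact: deviation_measurable.
by apply/seteqP; split=> w /= => [[t [Qt h]]|[t Qt h]]; exists t.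
Qed.

(** Exceedances by more than [1 / k.+1] are seen by the chains of mesh
    [1 / k.+1], whose bound does not depend on [k]; they increase to the
    exceedance event.  The factor 2 counts the two signs. *)
Lemma exceedance_bounded d K n c G (Q : nat -> Prop) (b : nat -> R) :
  0 <= d < 1 -> 0 < c -> (0 < n)%N ->
  1 <= 17 / 100 * ((1 + d) / (1 - d)) ^+ K ->
  G = 2 * (1 - d ^+ 2) * c ^+ 2 / n%:R -> 1 < 2 * G ->
  (forall t, Q t -> [/\ (0 < t <= n)%N, 0 <= b t & c <= t%:R * b t]) ->
  (P (exceedance Q b) <= (2 * (K.+1%:R * expR (1 - G) / (1 - (2 * G)^-1)))%:E)%E.
Proof.
move=> d01 c0 n0 hK GE G1 hQ.
pose H k := exceedance Q (fun t => b t + k.+1%:R^-1).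
have mH k : measurable (H k).
  apply: exceedance_measurable => t /hQ[/andP[t0 _] b0 _]; split => //.
  by rewrite addr_ge0.
have HE : exceedance Q b = \bigcup_k H k.
  apply/seteqP; split=> w /=.
    move=> [t [Qt /deviation_gtP[x bx]]].
    pose e := `|frequency Xs t w [set y | (y <= x)%O] - order_cdf P (Xs 0%N) x| - b t.
    have e0 : 0 < e by rewrite subr_gt0.
    exists (Num.truncn e^-1) => //; exists t; split => //.
    apply/deviation_gtP; exists x.
    have : (Num.truncn e^-1).+1%:R^-1 < e by rewrite invf_plt ?posrE// ?truncnS_gt.
    by rewrite /e ltrBrDl.
  move=> [k _ [t [Qt h]]]; exists t; split => //; apply: le_lt_trans h.
  by rewrite lee_fin lerDl.
have cvgH : (P \o H) @ \oo --> P (exceedance Q b).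
  rewrite HE; apply: nondecreasing_cvg_mu => //; first exact: bigcup_measurable.
  move=> j k jk; apply/subsetPset => w [t [Qt h]]; exists t; split => //.
  apply: le_lt_trans h; rewrite lee_fin lerD2l lef_pV2 ?posrE ?ltr0n// ler_nat.
  exact: jk.
rewrite -(cvg_lim _ cvgH)//; apply: lime_le; first by apply/cvg_ex; eexists; exact: cvgH.
apply: nearW => k /=.
have [mU PU] := @chain_crossing _ _ _ _ _ P Xs Xs_iid (up_chain P Xs k.+1) k.+2
  (@up_chain_nd _ _ _ _ _ P Xs k.+1) (up_chain_measurable X_complete Xs_iid k.+1) d K n c G d01 c0 n0 hK GE G1.
have [mD PD] := @chain_crossing _ _ _ _ _ P Xs Xs_iid (down_chain P Xs k.+1) k.+2
  (@down_chain_nd _ _ _ _ _ P Xs k.+1) (down_chain_measurable P Xs X_complete k.+1) d K n c G d01 c0 n0 hK GE G1.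
apply: le_trans (_ : _ <= P (chain_event P Xs (up_chain P Xs k.+1) k.+2 n c `|`
  chain_event P Xs (down_chain P Xs k.+1) k.+2 n c))%E _.
  apply: le_measure; rewrite ?inE//; first exact: measurableU.
  move=> w [t [Qt h]]; have [/andP[t0 tn] b0 cb] := hQ t Qt.
  have t0' : 0 < t%:R :> R by rewrite ltr0n.
  have scale B : b t < frequency Xs t w B - law P Xs B ->
      c <= \sum_(i < t) (Xs i w \in B)%:R - t%:R * law P Xs B.
    move=> hb; apply: le_trans cb _.
    have -> : \sum_(i < t) (Xs i w \in B)%:R - t%:R * law P Xs B =
       t%:R * (frequency Xs t w B - law P Xs B).
      by rewrite /frequency mulrBr mulrA mulfV ?gt_eqF// mul1r.
    by rewrite ler_pM2l// ltW.
  have [j jk [hj|hj]] := bracket X_complete Xs_iid Xs_regular (ltn0Sn k) t0 h.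
    by left; exists t, j; split => //; exact: scale.
  by right; exists t, j; split => //; exact: scale.
apply: le_trans (measureU2 _ mU mD) _.
by rewrite mulr2n mulrDl mul1r EFinD leeD.
Qed.

End Epochs.

(** * Summation over epochs *)

Section Series.
Context {R : realType}.

(** [(1 + l * k) ^ (- q)]. *)
Definition epoch_weight (l q : R) k := expR (- (q * ln (1 + l * k%:R))).

(** The discrete form of the primitive of [x ^ (- q)]. *)
Lemma epoch_weight_telescope l q k : 0 < l -> 1 < q ->
  epoch_weight l q k.+1 <=
  (epoch_weight l (q - 1) k - epoch_weight l (q - 1) k.+1) / (l * (q - 1)).
Proof.
move=> l0 q1; have q0 : 0 < q - 1 by lra.
rewrite ler_pdivlMr ?mulr_gt0// /epoch_weight.
set x := 1 + l * k.+1%:R; have xE : 1 + l * k%:R = x - l.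
  by rewrite /x -natr1; ring.
have k0 : 0 <= l * k%:R by rewrite mulr_ge0// ltW.
have y0 : 0 < x - l by rewrite -xE; lra.
have x0 : 0 < x by lra.
rewrite xE; set u := expR (- ((q - 1) * ln x)).
have -> : expR (- (q * ln x)) = u / x.
  rewrite /u -[X in _ / X](lnK (_ : x \is Num.pos)) ?posrE// -expRN -expRD.
  by congr expR; ring.
have h : u * (1 + (q - 1) * (l / x)) <= expR (- ((q - 1) * ln (x - l))).
  have -> : expR (- ((q - 1) * ln (x - l))) = u * expR ((q - 1) * (ln x - ln (x - l))).
    by rewrite /u -expRD; congr expR; ring.
  rewrite ler_wpM2l ?expR_ge0//; apply: le_trans (expR_ge1Dx _).
  rewrite lerD2l ler_pM2l// -ln_div ?posrE//.
  have -> : l / x = 1 - (x - l) / x by field; rewrite gt_eqF.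
  have := @le_ln1Dx R ((x - l) / x - 1).
  rewrite (_ : 1 + ((x - l) / x - 1) = (x - l) / x); last by ring.
  have r0 : 0 < (x - l) / x by rewrite divr_gt0.
  rewrite (_ : ln (x / (x - l)) = - ln ((x - l) / x)); last first.
    by rewrite -lnV ?posrE// invf_div.
  by move=> h; have := h (ltac:(lra)); lra.
have -> : u / x * (l * (q - 1)) = u * (1 + (q - 1) * (l / x)) - u by ring.
lra.
Qed.

Lemma epoch_weight_sum l q k0 N : 0 < l -> 1 < q ->
  \sum_(0 <= i < N) epoch_weight l q (k0 + i) <=
  epoch_weight l q k0 + epoch_weight l (q - 1) k0 / (l * (q - 1)).
Proof.
move=> l0 q1; have q0 : 0 < l * (q - 1) by rewrite mulr_gt0//; lra.
have w0 q' k : 0 <= epoch_weight l q' k by exact: expR_ge0.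
case: N => [|N]; first by rewrite big_nil addr_ge0// divr_ge0// ltW.
rewrite big_nat_recl//= addn0 lerD2l.
apply: (@le_trans _ _ ((epoch_weight l (q - 1) k0 - epoch_weight l (q - 1) (k0 + N))
   / (l * (q - 1)))); last first.
  by rewrite ler_pM2r ?invr_gt0// gerBl.
elim: N => [|N IH]; first by rewrite big_nil addn0 subrr mul0r.
rewrite big_nat_recr//=; apply: le_trans (lerD IH (_ : _ <= (epoch_weight l (q - 1) (k0 + N) -
   epoch_weight l (q - 1) (k0 + N.+1)) / (l * (q - 1)))) _.
  by rewrite !addnS; exact: epoch_weight_telescope.
by rewrite -mulrDl ler_pM2r ?invr_gt0// addrA subrK.
Qed.

Lemma epoch_weight_cvg0 l q e : 0 < l -> 0 < q -> 0 < e ->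
  exists k0, forall k, (k0 <= k)%N -> epoch_weight l q k <= e.
Proof.
move=> l0 q0 e0; set y := expR (- ln e / q).
exists (Num.truncn (y / l)).+1 => k hk.
rewrite /epoch_weight -[leRHS](lnK (_ : e \is Num.pos)) ?posrE// ler_expR.
rewrite lerNl -ler_pdivrMl// mulrC -(expRK (- ln e / q)) -/y.
have y0 : 0 < y by exact: expR_gt0.
have yk : y <= l * k%:R.
  rewrite mulrC -ler_pdivrMr//; apply: le_trans (ltW (truncnS_gt _)) _.
  by rewrite ler_nat.
by rewrite ler_ln ?posrE//; lra.
Qed.

Lemma expR1_lt : expR 1 < 35 / 12 :> R.
Proof.
have h : 7 / 8 <= expR (- (1 / 8)) :> R by apply: le_trans (expR_ge1Dx _); lra.
have {}h : expR (1 / 8) <= 8 / 7 :> R.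
  by rewrite expRN -(ler_pM2r (expR_gt0 (1 / 8))) mulVf ?gt_eqF ?expR_gt0// in h; lra.
have -> : expR 1 = expR (1 / 8) ^+ 8 :> R by rewrite -expRM_natl; congr expR; field.
apply: le_lt_trans (_ : _ <= (8 / 7) ^+ 8) _.
  by apply: lerXn2r => //; rewrite nnegrE ?expR_ge0//; lra.
by rewrite !exprS expr0; lra.
Qed.

End Series.

Section Boundary.
Context {R : realType} {dT : measure_display} {T : measurableType dT}.
Context {dX : Order.disp_t} {X : orderType dX}.
Variables (P : probability T R) (Xs : nat -> T -> X).
Hypothesis X_complete : order_complete X.
Hypothesis Xs_iid : iid P Xs.
Hypothesis Xs_regular : order_regular P (Xs 0%N).
Variables (A C m : R).
Hypothesis A0 : 0 < A.
Hypothesis C0 : 0 < C.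
Hypothesis m1 : 1 <= m.

Let m0 : 0 < m. Proof. exact: lt_le_trans m1. Qed.

Lemma lil_boundary_ge0 t : 0 <= lil_boundary A C m t.
Proof. by rewrite mulr_ge0 ?sqrtr_ge0// ltW. Qed.

Let level (l : R) k := ln (1 + l * k%:R) + C.

Let epoch_start (l : R) k := m * expR (l * k%:R).

Let start_gt0 l k : 0 < epoch_start l k.
Proof. by rewrite mulr_gt0// expR_gt0. Qed.

(** [t] times the boundary increases with [t], as does the iterated logarithm,
    which at the start of the k-th epoch is [ln (1 + l * k)]. *)
Lemma boundary_on_epoch l k t : 0 < l -> epoch_start l k <= t%:R ->
  A * Num.sqrt (epoch_start l k * level l k) <= t%:R * lil_boundary A C m t.
Proof.
move=> l0 kt; rewrite /lil_boundary mulrCA ler_pM2l//.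
have t0 : 0 < t%:R :> R := lt_le_trans (start_gt0 l k) kt.
have lk : 0 <= l * k%:R by rewrite mulr_ge0// ltW.
have lt : l * k%:R <= ln (t%:R / m).
  rewrite -ler_expR lnK ?posrE ?divr_gt0// ler_pdivlMr// mulrC; exact: kt.
have lE : ln (expR 1 * t%:R / m) = 1 + ln (t%:R / m).
  by rewrite -mulrA lnM ?posrE ?expR_gt0 ?divr_gt0// expRK.
have hl : level l k <= ln (ln (expR 1 * t%:R / m)) + C.
  by rewrite lerD2r lE ler_ln ?posrE//; lra.
have l1 : 0 <= level l k by rewrite addr_ge0 ?(ltW C0)// ln_ge0//; lra.
rewrite -[X in _ <= X * _](ger0_norm (ltW t0)) -sqrtr_sqr -sqrtrM ?sqr_ge0//.
apply: ler_wsqrtr; set L := _ + C in hl *.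
have -> : t%:R ^+ 2 * (L / t%:R) = t%:R * L by field; rewrite gt_eqF.
by apply: ler_pM => //; rewrite ltW.
Qed.

Variables (d l q : R) (K : nat).
Hypothesis d01 : 0 <= d < 1.
Hypothesis hK : 1 <= 17 / 100 * ((1 + d) / (1 - d)) ^+ K.
Hypothesis l0 : 0 < l.
Hypothesis q1 : 1 < q.
Hypothesis hq : q <= 2 * (1 - d ^+ 2) * A ^+ 2 * expR (- l).

Definition late_exceedance k0 :=
  exceedance P Xs (fun t => epoch_start l k0 <= t%:R) (lil_boundary A C m).

Let q0 : 0 < q. Proof. exact: lt_trans q1. Qed.

Let ge_start_gt0 k t : epoch_start l k <= t%:R -> (0 < t)%N.
Proof. by move=> /(lt_le_trans (start_gt0 l k)); rewrite ltr0n. Qed.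

Lemma late_exceedance_measurable k0 : measurable (late_exceedance k0).
Proof.
apply: exceedance_measurable => // t /ge_start_gt0 t0; split => //.
exact: lil_boundary_ge0.
Qed.

Let one_epoch k := exceedance P Xs
  (fun t => epoch_start l k <= t%:R < epoch_start l k.+1) (lil_boundary A C m).

(** The epoch contributes through its last time [n] and the level [c] at its
    first time; their mismatch is the factor [expR (- l)] in the constraint on
    [q]. *)
Lemma one_epoch_bound g k : 1 < 2 * g -> g <= q * level l k ->
  (P (one_epoch k) <=
   (2 * (K.+1%:R * expR (1 - q * C) / (1 - (2 * g)^-1)) * epoch_weight l q k)%:E)%E.
Proof.
move=> g1 gq.
have [[t0 ht0]|none] := pselect (exists t : nat, epoch_start l k <= t%:R < epoch_start l k.+1);
    last first.
  rewrite (_ : one_epoch k = set0) ?measure0 ?lee_fin.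
    rewrite !mulr_ge0 ?expR_ge0 ?invr_ge0// subr_ge0 invf_le1; lra.
  by apply/seteqP; split=> w //= [t [ht _]]; apply: none; exists t.
pose n := Num.truncn (epoch_start l k.+1).
have nle : n%:R <= epoch_start l k.+1 by rewrite truncn_le ltW.
have tn t : t%:R < epoch_start l k.+1 -> (t <= n)%N.
  by move=> h; rewrite truncn_ge_nat ?ltW.
have n0 : (0 < n)%N.
  have /andP[h1 h2] := ht0.
  exact: leq_trans (ge_start_gt0 h1) (tn _ h2).
have lk : 0 <= l * k%:R by rewrite mulr_ge0// ltW.
have lev0 : 0 < level l k by rewrite ltr_wpDl// ln_ge0//; lra.
pose c := A * Num.sqrt (epoch_start l k * level l k).
have c0 : 0 < c by rewrite mulr_gt0// sqrtr_gt0 mulr_gt0.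
have G1 : q * level l k <= 2 * (1 - d ^+ 2) * c ^+ 2 / n%:R.
  have n0' : 0 < n%:R :> R by rewrite ltr0n.
  rewrite ler_pdivlMr// exprMn sqr_sqrtr; last exact/ltW/mulr_gt0.
  have d2 : 0 <= 2 * (1 - d ^+ 2).
    by have /andP[d0 d1] := d01; rewrite mulr_ge0// subr_ge0 expr_le1// ltW.
  have h1 : q * n%:R <= (2 * (1 - d ^+ 2) * A ^+ 2 * expR (- l)) * epoch_start l k.+1.
    by apply: ler_pM => //; apply: ltW; apply: lt_trans q1.
  have h2 : expR (- l) * epoch_start l k.+1 = epoch_start l k.
    rewrite /epoch_start mulrCA -expRD; congr (_ * expR _).
    by rewrite -natr1; ring.
  have := ler_wpM2r (ltW lev0) h1; rewrite -(mulrA _ (expR (- l))) h2 => h3.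
  by rewrite mulrAC; apply: le_trans h3 _; rewrite !mulrA.
have g0 : 0 < g by lra.
set G := 2 * _ * c ^+ 2 / _ in G1.
have gG : g <= G by lra.
apply: le_trans (exceedance_bounded X_complete Xs_iid Xs_regular d01 c0 n0 hK
   (erefl G) _ _) _.
- by lra.
- move=> t /andP[h1 h2]; split; first by rewrite (ge_start_gt0 h1) tn.
    exact: lil_boundary_ge0.
  exact: boundary_on_epoch.
have inv_le : (2 * G)^-1 <= (2 * g)^-1 by rewrite lef_pV2 ?posrE; lra.
have inv_lt : (2 * g)^-1 < 1 by rewrite invf_lt1; lra.
have -> : 2 * (K.+1%:R * expR (1 - q * C) / (1 - (2 * g)^-1)) * epoch_weight l q k =
  2 * (K.+1%:R * expR (1 - q * level l k) / (1 - (2 * g)^-1)).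
  have -> : expR (1 - q * level l k) = expR (1 - q * C) * epoch_weight l q k.
    by rewrite -expRD; congr expR; rewrite /level; ring.
  by ring.
rewrite lee_fin ler_pM2l//; apply: ler_pM.
- by rewrite mulr_ge0 ?expR_ge0.
- by rewrite invr_ge0; lra.
- by rewrite ler_wpM2l// ler_expR; lra.
- by rewrite lef_pV2 ?posrE; lra.
Qed.

Lemma late_exceedance_bound g k0 : 1 < 2 * g -> g <= q * level l k0 ->
  (P (late_exceedance k0) <=
   (2 * (K.+1%:R * expR (1 - q * C) / (1 - (2 * g)^-1)) *
    (epoch_weight l q k0 + epoch_weight l (q - 1) k0 / (l * (q - 1))))%:E)%E.
Proof.
move=> g1 gq; set B := 2 * _.
have B0 : 0 <= B.
  by rewrite !mulr_ge0 ?expR_ge0 ?invr_ge0// subr_ge0 invf_le1; lra.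
have mone k : measurable (one_epoch k).
  apply: exceedance_measurable => // t /andP[/ge_start_gt0 t0 _]; split => //.
  exact: lil_boundary_ge0.
have levk k : (k0 <= k)%N -> g <= q * level l k.
  move=> kk; apply: le_trans gq _; rewrite ler_pM2l ?q0//.
  have lk j : 0 <= l * j%:R by rewrite mulr_ge0// ltW.
  rewrite lerD2r ler_ln ?posrE ?ltr_wpDr// lerD2l ler_wpM2l ?ler_nat// ltW//.
apply: le_trans (@measure_sigma_subadditive _ _ _ P (late_exceedance k0)
   (fun i => one_epoch (k0 + i)) _ _ _) _.
- by move=> i; exact: mone.
- exact: late_exceedance_measurable.
- move=> w [t [kt h]].
  have ex : exists i, t%:R < epoch_start l (k0 + i).+1.
    have [y y0 ty] : exists2 y : R, 0 < y & t%:R / m <= expR y.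
      exists (t%:R / m + 1); first by rewrite ltr_wpDl// divr_ge0// ltW.
      by apply: le_trans (expR_ge1Dx _); rewrite addrCA lerDl.
    exists (Num.truncn (y / l)); rewrite /epoch_start -ltr_pdivrMl// mulrC.
    apply: le_lt_trans ty _; rewrite ltr_expR mulrC -ltr_pdivrMr//.
    by apply: lt_le_trans (truncnS_gt _) _; rewrite ler_nat ltnS leq_addl.
  case: (ex_minnP ex) => i ti imin; exists i => //; exists t; split => //.
  rewrite ti andbT; case: i {ti} imin => [|i] imin; first by rewrite addn0.
  by rewrite leNgt; apply/negP; rewrite addnS => /imin; rewrite ltnn.
apply: lime_le; first by apply: is_cvg_nneseries.
apply: nearW => N.
apply: (@le_trans _ _ (\sum_(0 <= i < N) (B * epoch_weight l q (k0 + i))%:E)%E).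
  by apply: lee_sum => i _; apply: one_epoch_bound => //; apply: levk; exact: leq_addr.
by rewrite sumEFin lee_fin -mulr_sumr ler_wpM2l// epoch_weight_sum.
Qed.

End Boundary.

(** * The iterated-logarithm bounds *)

(** Bernoulli's inequality for the ratio of two consecutive bands. *)
Lemma exists_bands {R : realType} (d : R) : 0 < d < 1 ->
  exists K, 1 <= 17 / 100 * ((1 + d) / (1 - d)) ^+ K.
Proof.
move=> /andP[d0 d1]; set r := (1 + d) / (1 - d).
have r1 : 1 + d <= r by rewrite ler_pdivlMr; [have := mulr_gt0 d0 d0; nra|lra].
have bern K : 1 + d * K%:R <= r ^+ K.
  elim: K => [|K IH]; first by rewrite mulr0 addr0 expr0.
  rewrite exprS -natr1; have K0 : 0 <= K%:R :> R by [].
  have := ler_pM (_ : 0 <= 1 + d) (_ : 0 <= 1 + d * K%:R) r1 IH.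
  have dK := mulr_ge0 (ltW d0) K0.
  move=> /(_ (ltac:(lra)) (ltac:(lra))); have := mulr_ge0 (ltW d0) dK; nra.
exists (Num.truncn (6 / d)).+1.
have h := truncnS_gt (6 / d); move: (Num.truncn _).+1 h => K h.
have := bern K; move: h; rewrite ltr_pdivrMr// mulrC; lra.
Qed.

Unset Implicit Arguments.

Theorem theorem2 (R : realType) (dT : measure_display) (T : measurableType dT)
    (P : probability T R) (dX : Order.disp_t) (X : orderType dX)
    (Xs : nat -> T -> X)
    (X_complete : order_complete X)
    (Xs_iid : iid P Xs)
    (Xs_regular : order_regular P (Xs 0%N)) :
  (forall m C : R, 1 <= m -> 7 <= C ->
     (P [set w | exists t : nat, (m <= t%:R)%R /\
           (lil_boundary (85 / 100) C m t)%:E < cdf_deviation P Xs t w]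
      <= (1612 * expR (- (125 / 100 * C)))%:E)%E) /\
  (forall A C m : R, 1 / Num.sqrt 2 < A -> 0 < C -> 1 <= m ->
     P [set w | infinite_set [set t : nat | (1 <= t)%N /\
          ((lil_boundary A C m t)%:E < cdf_deviation P Xs t w)%E]]
     = 0%E).
Proof.
split.
- move=> m C m1 C7.
  have A0 : 0 < 85 / 100 :> R by lra.
  have C0 : 0 < C by lra.
  (* Five bands reach from 17/100 to 1 since (59/41)^5 > 100/17, so the constant
     of the two-sided crossing bound is 12; since q > 1.25, the excess
     exp(- 0.09 C) <= exp(- 0.6) of the exponential over the claimed one pays,
     with the room left in 1612, for the length 1/25 of the epochs. *)
  pose d : R := 9 / 50; pose l : R := 1 / 25; pose q : R := 67 / 50.
  have d01 : 0 <= d < 1 by rewrite /d; lra.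
  have hK : 1 <= 17 / 100 * ((1 + d) / (1 - d)) ^+ 5.
    have -> : (1 + d) / (1 - d) = 59 / 41 by rewrite /d; field.
    by rewrite !exprS expr0; lra.
  have l0 : 0 < l by rewrite /l; lra.
  have q1 : 1 < q by rewrite /q; lra.
  have hq : q <= 2 * (1 - d ^+ 2) * (85 / 100) ^+ 2 * expR (- l).
    have := expR_ge1Dx (- l); rewrite /q /d /l; lra.
  (* 9 bounds q * C from below, which controls the correction in
     Doob's inequality. *)
  have g1 : 1 < 2 * (9 : R) by lra.
  have := late_exceedance_bound X_complete Xs_iid Xs_regular A0 C0 m1 d01 hK l0 q1 hq (k0 := 0) g1.
  rewrite mulr0 addr0 ln1 add0r => /(_ (ltac:(rewrite /q; lra))).
  rewrite (_ : late_exceedance _ _ _ _ _ _ _ =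
     [set w | exists t : nat, (m <= t%:R)%R /\
       ((lil_boundary (85 / 100) C m t)%:E < cdf_deviation P Xs t w)%E]); last first.
    by rewrite /late_exceedance /exceedance mulr0 expR0 mulr1.
  move=> h; apply: le_trans h _; rewrite lee_fin.
  have -> : epoch_weight l q 0 = 1 by rewrite /epoch_weight mulr0 addr0 ln1 mulr0 oppr0 expR0.
  have -> : epoch_weight l (q - 1) 0 = 1 by rewrite /epoch_weight mulr0 addr0 ln1 mulr0 oppr0 expR0.
  have e1 := @expR1_lt R.
  have e2 : expR (1 - q * C) <= expR 1 * (expR (- (125 / 100 * C)) * (23 / 40)).
    have -> : expR (1 - q * C) = expR 1 * (expR (- (125 / 100 * C)) * expR (- (9 / 100 * C))).
      by rewrite -!expRD; congr expR; rewrite /q; field.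
    rewrite !ler_wpM2l ?expR_ge0//.
    apply: (@le_trans _ _ (expR (- (4%:R * (3 / 20))))).
      by rewrite ler_expR; lra.
    rewrite expRN expRM_natl.
    have x1 : 23 / 20 <= expR (3 / 20) :> R.
      by apply: le_trans (expR_ge1Dx _); lra.
    have x4 : (23 / 20) ^+ 4 <= expR (3 / 20) ^+ 4 :> R.
      by apply: lerXn2r; rewrite ?nnegrE ?expR_ge0//; lra.
    rewrite -[leRHS]invrK lef_pV2 ?posrE ?exprn_gt0 ?expR_gt0//.
    by apply: le_trans x4; rewrite !exprS expr0; lra.
  set E := expR (- _) in e2 *; have E0 : 0 < E by exact: expR_gt0.
  have e3 : expR (1 - q * C) <= 35 / 12 * (E * (23 / 40)).
    by apply: le_trans e2 _; rewrite ler_wpM2r ?mulr_ge0 ?(ltW E0)// ltW.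
  have -> : 2 * (6%:R * expR (1 - q * C) / (1 - (2 * 9)^-1)) * (1 + 1 / (l * (q - 1)))
      = (2 * 6 / (1 - (2 * 9)^-1) * (1 + 1 / (l * (q - 1)))) * expR (1 - q * C) :> R by ring.
  have -> : 2 * 6 / (1 - (2 * 9)^-1) * (1 + 1 / (l * (q - 1))) =
      216 / 17 * (1 + 1250 / 17) :> R by rewrite /l /q; field.
  lra.
- move=> A C m hA C0 m1.
  have s2 : 0 < Num.sqrt 2 :> R by rewrite sqrtr_gt0.
  have A0 : 0 < A by apply: lt_trans hA; rewrite divr_gt0.
  have A2 : 1 < 2 * A ^+ 2.
    rewrite -[2](sqr_sqrtr (_ : 0 <= 2)) -?exprMn ?exprn_egt1//.
    by rewrite ltr_pdivrMr// mulrC in hA.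
  (* The same small e serves as width of the bands and length of the epochs:
     q = 2 A^2 (1 - 2 e) is then the midpoint between 1 and 2 A^2. *)
  pose e := (2 * A ^+ 2 - 1) / (4 * (2 * A ^+ 2)).
  have e0 : 0 < e by rewrite divr_gt0//; lra.
  have e1 : e < 1 / 4 by rewrite ltr_pdivrMr; lra.
  have [|K hK] := exists_bands (d := e); first by lra.
  pose q := (2 * A ^+ 2 + 1) / 2.
  have q1 : 1 < q by rewrite /q; lra.
  have e01 : 0 <= e < 1 by lra.
  have hq : q <= 2 * (1 - e ^+ 2) * A ^+ 2 * expR (- e).
    apply: (@le_trans _ _ (2 * A ^+ 2 * (1 - 2 * e))).
      have -> : q = 2 * A ^+ 2 * (1 - 2 * e) by rewrite /q /e; field; lra.
      by [].
    have -> : 2 * (1 - e ^+ 2) * A ^+ 2 * expR (- e) = 2 * A ^+ 2 * ((1 - e ^+ 2) * expR (- e)).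
      by ring.
    have A20 : 0 <= 2 * A ^+ 2 by lra.
    rewrite ler_wpM2l//.
    apply: (@le_trans _ _ ((1 - e ^+ 2) * (1 - e))); first by nra.
    rewrite ler_wpM2l ?expR_ge1Dx// subr_ge0 expr_le1//; lra.
  pose E k := late_exceedance P Xs A C m e k.
  have mE k : measurable (E k).
    exact: late_exceedance_measurable.
  set S := [set w | _].
  have SE : S = \bigcap_k E k.
    apply/seteqP; split=> w.
      move=> inf k _; apply: contrapT => nE; apply: inf.
      apply: (@sub_finite_set _ _ `I_(Num.truncn (m * expR (e * k%:R))).+1).
        move=> t [t1 ht] /=; rewrite ltnNge; apply/negP => kt; apply: nE.
        exists t; split => //; apply: le_trans (ltW (truncnS_gt _)) _.
        by rewrite ler_nat.
      exact: finite_II.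
    move=> wE fin.
    have [N hN] : exists N, [set t | (1 <= t)%N /\
        ((lil_boundary A C m t)%:E < cdf_deviation P Xs t w)%E] `<=` `I_N.
      exists (\max_(i <- finmap.enum_fset (fset_set
        [set t | (1 <= t)%N /\ ((lil_boundary A C m t)%:E < cdf_deviation P Xs t w)%E])) i).+1.
      move=> t ht /=; rewrite ltnS; apply: leq_bigmax_seq => //.
      by rewrite in_fset_set// inE.
    have [t [kt ht]] := wE (Num.truncn (N%:R / e)).+1 I.
    have Nt : N%:R <= t%:R :> R.
      apply: le_trans kt; set y := e * _.
      have yN : N%:R <= y.
        by rewrite /y mulrC -ler_pdivrMr// ltW// truncnS_gt.
      have := expR_ge1Dx y; have := expR_ge0 y => h1 h2.
      have : 1 * expR y <= m * expR y by rewrite ler_wpM2r.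
      lra.
    have t0 : (0 < t)%N.
      rewrite -(ltr0n R); apply: lt_le_trans kt.
      by rewrite mulr_gt0 ?expR_gt0//; lra.
    have := hN t (conj t0 ht); rewrite /= ltnNge.
    by move: Nt; rewrite ler_nat => ->.
  have mS : measurable S by rewrite SE; apply: bigcap_measurable.
  apply/eqP; rewrite eq_le measure_ge0 andbT.
  apply/lee_addgt0Pr => z z0; rewrite add0e.
  set B := 2 * (K.+1%:R * expR (1 - q * C) / (1 - (2 * 1)^-1)).
  have B0 : 0 < B by rewrite !mulr_gt0 ?expR_gt0 ?invr_gt0 ?ltr0n//; lra.
  pose W := 1 + (e * (q - 1))^-1.
  have eq0 : 0 < e * (q - 1) by rewrite mulr_gt0//; lra.
  have W0 : 0 < W by rewrite ltr_wpDr// invr_ge0 ltW.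
  have zBW : 0 < z / (B * W) by rewrite divr_gt0// mulr_gt0.
  have q0 : 0 < q by lra.
  have q10 : 0 < q - 1 by lra.
  have [k1 hk1] := epoch_weight_cvg0 e0 q0 zBW.
  have [k2 hk2] := epoch_weight_cvg0 e0 q10 zBW.
  have [k3 hk3] := epoch_weight_cvg0 e0 q0 (expR_gt0 (-1)).
  pose k := maxn k1 (maxn k2 k3).
  have k1k : (k1 <= k)%N by rewrite leq_maxl.
  have k2k : (k2 <= k)%N by rewrite /k maxnCA leq_maxl.
  have k3k : (k3 <= k)%N by rewrite /k maxnA leq_maxr.
  have lk : 1 <= q * (ln (1 + e * k%:R) + C).
    have := hk3 k k3k; rewrite /epoch_weight ler_expR.
    by have := mulr_gt0 q0 C0; lra.
  apply: (@le_trans _ _ (P (E k))).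
    by apply: le_measure; rewrite ?inE// SE => w; apply.
  apply: le_trans (late_exceedance_bound X_complete Xs_iid Xs_regular A0 C0 m1
    e01 hK e0 q1 hq (_ : 1 < 2 * 1) lk) _; first by lra.
  rewrite lee_fin -/B.
  apply: (@le_trans _ _ (B * (z / (B * W) * W))); last first.
    by rewrite mulrCA divfK// gt_eqF// mulr_gt0.
  rewrite ler_pM2l//; move: (z / _) hk1 hk2 => zz hk1 hk2.
  have -> : zz * W = zz + zz / (e * (q - 1)) by rewrite /W mulrDr mulr1.
  rewrite lerD ?hk1// ler_wpM2r ?invr_ge0 ?(ltW eq0)//.
  exact: hk2.
Qed.
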